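(* There exist absolute constants $c,C>0$ such that the following holds. Let $k\geq 2$, $m\geq1$ and $N$ be integers with $m\mid N$, let $d=c\sqrt m$, and let $F$ be the $(k,N,m,\mathrm{OR}_m)$-pattern tensor, viewed as a $k$-party number-on-forehead communication problem. If $N\geq 4e\,m^2(k-1)2^{2^{k-1}}/d$, then \[N(-F)\geq C\,\frac{\sqrt m}{2^k}\qquad\text{and}\qquad \mathit{MA}(-F)\geq C\,\frac{m^{1/4}}{2^{k/2}}.\]
   Context: $\mathrm{OR}_m:\{0,1\}^m\to\{-1,+1\}$ is given by $\mathrm{OR}_m(z)=+1$ iff $z=0$ (here $-1$ means ''true''). For $\phi:\{0,1\}^m\to\mathbb{R}$ and $m\mid N$, the $(k,N,m,\phi)$-pattern tensor is the $k$-argument function $A:\{0,1\}^{m(N/m)^{k-1}}\times[N/m]^m\times\cdots\times[N/m]^m\to\mathbb{R}$ (with $k-1$ copies of $[N/m]^m$) given by $A(x,V_1,\dots,V_{k-1})=\phi(x_{1,V_1[1],\dots,V_{k-1}[1]},\dots,x_{m,V_1[m],\dots,V_{k-1}[m]})$, where $x$ is viewed as a $k$-dimensional array of size $m\times(N/m)\times\cdots\times(N/m)$ and $V_j[i]$ is the $i$th entry of $V_j$. In the number-on-forehead model, the $k$ arguments are placed on the foreheads of players $1,\dots,k$ (player $i$ sees all arguments but the $i$th); players write bits on a shared blackboard. $N(G)$ is the least cost $c_1+c_2$ of a nondeterministic protocol ($c_1$ nondeterministic bits then $c_2$ deterministic bits), correct for at least one nondeterministic choice when $G=-1$ and for all choices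 when $G=+1$. $\mathit{MA}(G)$ is the least cost $c_1+c_2$ of a Merlin-Arthur protocol: $c_1$ nondeterministic bits then $c_2$ bits of public-coin randomized communication, with error at most $1/3$ for at least one nondeterministic choice when $G=-1$ and for all choices when $G=+1$. *)

(* Defs.v *)
From HB Require Import structures.
From mathcomp Require Import all_boot all_order all_algebra.
From mathcomp Require Import boolp classical_sets reals.
From mathcomp Require Import sequences exp.

Set Implicit Arguments.
Unset Strict Implicit.
Unset Printing Implicit Defensive.

Import Order.TTheory GRing.Theory Num.Theory.

Local Open Scope ring_scope.

(* Number-on-forehead protocols. [P] is the set of players, and [X i] the set
   of strings that can be on the forehead of player [i]. *)

(* What player [i] sees: every argument except the [i]th. *)
Definition view (P : finType) (X : P -> Type) (i : P) : Type :=
  forall j : {j : P | j != i}, X (val j).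

(* At [Speak i f p0 p1] player [i] writes the bit [f v], where [v] is the view
   of [i]; the bits written so far are recorded by the position in the tree. *)
Inductive protocol (P : finType) (X : P -> Type) : Type :=
| Output of bool
| Speak (i : P) of (view X i -> bool) & protocol X & protocol X.

Fixpoint run (P : finType) (X : P -> Type) (p : protocol X)
    (z : forall i, X i) : bool :=
  match p with
  | Output b => b
  | Speak i f p0 p1 =>
      if f (fun j => z (val j)) then run p1 z else run p0 z
  end.

Fixpoint cost (P : finType) (X : P -> Type) (p : protocol X) : nat :=
  match p with
  | Output _ => 0
  | Speak _ _ p0 p1 => (maxn (cost p0) (cost p1)).+1
  end.

(* Outputs [true], [false] stand for the values -1, +1. *)
Definition correct (R : realType) (P : finType) (X : P -> Type)
    (G : (forall i, X i) -> R) (p : protocol X) (z : forall i, X i) : bool :=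
  (-1) ^+ run p z == G z.

Definition has_nondet_protocol (R : realType) (P : finType) (X : P -> Type)
    (G : (forall i, X i) -> R) (c1 c2 : nat) : Prop :=
  exists p : c1.-tuple bool -> protocol X,
    (forall g, (cost (p g) <= c2)%N) /\
    (forall z, G z = -1 -> exists g, correct G (p g) z) /\
    (forall z, G z = 1 -> forall g, correct G (p g) z).

(* Public coins form a finite probability space [(T, mu)]. For finite [X i]
   this is no restriction: up to equality of [run], there are only finitely many
   deterministic protocols of a given cost. *)
Definition has_MA_protocol (R : realType) (P : finType) (X : P -> Type)
    (G : (forall i, X i) -> R) (c1 c2 : nat) : Prop :=
  exists (T : finType) (mu : T -> R) (p : c1.-tuple bool -> T -> protocol X),
    let err g z := \sum_(t | ~~ correct G (p g t) z) mu t in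
    (forall t, 0 <= mu t) /\ \sum_t mu t = 1 /\
    (forall g t, (cost (p g t) <= c2)%N) /\
    (forall z, G z = -1 -> exists g, err g z <= 3^-1) /\
    (forall z, G z = 1 -> forall g, err g z <= 3^-1).

(* The default value 0 is returned only when no [c1], [c2] satisfy [Q]. *)
Definition least_cost (Q : nat -> nat -> Prop) : nat :=
  let costs := [set c | exists c1 c2, Q c1 c2 /\ c = (c1 + c2)%N]%classic in
  xget 0%N [set c | costs c /\ forall c', costs c' -> (c <= c')%N]%classic.

Definition nondet_complexity (R : realType) (P : finType) (X : P -> Type)
    (G : (forall i, X i) -> R) : nat :=
  least_cost (has_nondet_protocol G).

Definition MA_complexity (R : realType) (P : finType) (X : P -> Type)
    (G : (forall i, X i) -> R) : nat :=
  least_cost (has_MA_protocol G).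

(* The [k] players are [None], holding the array [x], and [Some j] for
   [j : 'I_k.-1], holding [V_(j+1)]. *)
Definition pattern_arg (k N m : nat) (i : option 'I_k.-1) : finType :=
  match i with
  | None => {ffun 'I_m * {ffun 'I_k.-1 -> 'I_(N %/ m)} -> bool}
  | Some _ => {ffun 'I_m -> 'I_(N %/ m)}
  end.

Definition pattern_tensor (R : realType) (k N m : nat)
    (phi : {ffun 'I_m -> bool} -> R)
    (z : forall i : option 'I_k.-1, pattern_arg N m i) : R :=
  let x : {ffun 'I_m * {ffun 'I_k.-1 -> 'I_(N %/ m)} -> bool} := z None in
  let V (j : 'I_k.-1) : {ffun 'I_m -> 'I_(N %/ m)} := z (Some j) in
  phi [ffun i => x (i, [ffun j => V j i])].

Definition OR (R : realType) (m : nat) (z : {ffun 'I_m -> bool}) : R :=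
  if [forall i, ~~ z i] then 1 else -1.

(* Main.v *)
(* A function [psi] on the cube that is orthogonal to all functions of at most
   [D ~ sqrt m] coordinates, has L1 norm 1 and puts constant weight on 0 is
   obtained as [(-1)^|z|] times the polynomial in [|z|] that vanishes at every
   integer of [0..m] outside the squares [i^2], [i <= D], and 2. Its pattern
   tensor correlates poorly with cylinder intersections: after [k - 1]
   Cauchy-Schwarz steps one averages a product of [2^(k-1)] copies of [psi],
   which vanishes unless more than [D] rows see a collision between the two
   copies of the [V_j], an event whose contribution is at most [2^-(D+1)] when
   [N / m] is large. A deterministic protocol of cost [c] is a sum of [2^c]
   cylinder intersections. Summing acceptance indicators over all guesses gives
   a function that is at least 1 where the selected bits are all 0 and at most
   1/32 elsewhere, hence correlates with [psi], and the two bounds together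
   bound the cost from below. In the Merlin-Arthur case the acceptance
   probabilities are first raised to a power of order [c1], which turns [c2]
   into a multiple of [c1 * c2]: this is the source of the square root. *)
Require Import Defs.
From HB Require Import structures.
From mathcomp Require Import all_boot all_order all_algebra.
From mathcomp Require Import boolp classical_sets reals.
From mathcomp Require Import sequences exp.
From mathcomp Require Import zify ring lra.

Set Implicit Arguments.
Unset Strict Implicit.
Unset Printing Implicit Defensive.

Import Order.TTheory GRing.Theory Num.Theory.

Local Open Scope ring_scope.

(** * Averages over finite types *)

(** On an empty type the average is 0, because [0^-1 = 0]; hence the point required by [expect_cst]
    and the sign condition in [expect_cst_le]. *)
Definition expect (R : realFieldType) (T : finType) (F : T -> R) : R :=
  #|T|%:R^-1 * \sum_t F t.

Local Notation "\E_ ( x : T ) F" := (expect (fun x : T => F))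
  (at level 41, F at level 41, x, T at level 50,
   format "'[' \E_ ( x : T ) '/  '  F ']'").

Section Expectation.
Variable R : realFieldType.
Implicit Types T U W I : finType.

Lemma eq_expect T (F G : T -> R) : F =1 G -> expect F = expect G.
Proof. by move=> FG; rewrite /expect; congr (_ * _); apply: eq_bigr. Qed.

Lemma expect_swap T U (F : T -> U -> R) :
  \E_(x : T) \E_(y : U) F x y = \E_(y : U) \E_(x : T) F x y.
Proof.
rewrite /expect -!mulr_sumr !mulrA [X in X * _]mulrC; congr (_ * _).
exact: exchange_big.
Qed.

Lemma expect_pair T U (F : T -> U -> R) :
  \E_(p : T * U) F p.1 p.2 = \E_(x : T) \E_(y : U) F x y.
Proof.
rewrite /expect -mulr_sumr mulrA card_prod natrM invfM; congr (_ * _).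
by rewrite [RHS]pair_big.
Qed.

Lemma expectZ T (a : R) (F : T -> R) : \E_(x : T) (a * F x) = a * expect F.
Proof. by rewrite /expect -mulr_sumr mulrCA. Qed.

Lemma expectD T (F G : T -> R) :
  \E_(x : T) (F x + G x) = expect F + expect G.
Proof. by rewrite /expect big_split mulrDr. Qed.

Lemma expect_sum T (J : Type) (r : seq J) (F : J -> T -> R) :
  \E_(x : T) (\sum_(j <- r) F j x) = \sum_(j <- r) expect (F j).
Proof. by rewrite /expect -mulr_sumr exchange_big. Qed.

Lemma ler_expect T (F G : T -> R) :
  (forall x, F x <= G x) -> expect F <= expect G.
Proof.
by move=> FG; rewrite /expect ler_wpM2l ?invr_ge0 ?ler0n ?ler_sum.
Qed.

Lemma expect_ge0 T (F : T -> R) : (forall x, 0 <= F x) -> 0 <= expect F.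
Proof. by move=> F0; rewrite /expect mulr_ge0 ?invr_ge0 ?ler0n ?sumr_ge0. Qed.

Lemma ler_norm_expect T (F : T -> R) : `|expect F| <= \E_(x : T) `|F x|.
Proof.
rewrite /expect normrM ger0_norm ?invr_ge0 ?ler0n //.
by rewrite ler_wpM2l ?invr_ge0 ?ler0n ?ler_norm_sum.
Qed.

Lemma expect_cst T (x0 : T) (a : R) : \E_(x : T) a = a.
Proof.
rewrite /expect sumr_const -[a *+ _]mulr_natl mulrA mulVf ?mul1r //.
by rewrite pnatr_eq0 -lt0n; apply/card_gt0P; exists x0.
Qed.

Lemma expect_cst_le T (a : R) : 0 <= a -> \E_(x : T) a <= a.
Proof.
case: (pickP T) => [x0 _ _|T0 a0]; first by rewrite (expect_cst x0).
by rewrite /expect eq_card0 // invr0 mul0r.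
Qed.

Lemma expect_reindex T U (h : U -> T) (F : T -> R) :
  bijective h -> expect F = \E_(x : U) F (h x).
Proof.
move=> hb; rewrite /expect (reindex h) /=; last exact: onW_bij.
by rewrite (bij_eq_card hb).
Qed.

Lemma expect_sqr_le T (F : T -> R) : expect F ^+ 2 <= \E_(x : T) F x ^+ 2.
Proof.
case: (pickP T) => [x0 _|T0]; last first.
  by rewrite /expect eq_card0 // invr0 !mul0r expr0n.
have : 0 <= \E_(x : T) (F x - expect F) ^+ 2.
  by apply: expect_ge0 => x; exact: sqr_ge0.
rewrite (@eq_expect _ _ (fun x => F x ^+ 2 + (- 2 * expect F * F x
           + expect F ^+ 2))); last by move=> x; ring.
rewrite !expectD expectZ (expect_cst x0) => h.
have e : \E_(x : T) F x ^+ 2 + (- 2 * expect F * expect F + expect F ^+ 2) =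
  \E_(x : T) F x ^+ 2 - expect F ^+ 2 by ring.
by rewrite -subr_ge0 -e.
Qed.

Lemma expect_prod I W (F : I -> W -> R) :
  \E_(V : {ffun I -> W}) \prod_i F i (V i) = \prod_i expect (F i).
Proof.
rewrite /expect big_split prodr_const /= bigA_distr_bigA; congr (_ * _).
by rewrite card_ffun natrX exprVn.
Qed.

End Expectation.

(** * Splitting off a coordinate, and Cauchy-Schwarz over a cube of copies *)

Definition ffun_cons (r : nat) (W : Type) (w : W) (V : {ffun 'I_r -> W}) :
  {ffun 'I_r.+1 -> W} := [ffun i => oapp V w (unlift ord0 i)].

Lemma ffun_cons0 r (W : Type) (w : W) (V : {ffun 'I_r -> W}) :
  ffun_cons w V ord0 = w.
Proof. by rewrite ffunE unlift_none. Qed.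

Lemma ffun_consS r (W : Type) (w : W) (V : {ffun 'I_r -> W}) j :
  ffun_cons w V (lift ord0 j) = V j.
Proof. by rewrite ffunE liftK. Qed.

Lemma ffun_cons_bij r (W : Type) :
  bijective (fun p : W * {ffun 'I_r -> W} => ffun_cons p.1 p.2).
Proof.
exists (fun V : {ffun 'I_r.+1 -> W} =>
  (V ord0, [ffun j : 'I_r => V (lift ord0 j)])) => [[w V]|V] /=.
  rewrite ffun_cons0; congr pair; apply/ffunP => j.
  by rewrite ffunE ffun_consS.
apply/ffunP => i; case: (unliftP ord0 i) => [j|] ->.
  by rewrite ffun_consS ffunE.
by rewrite ffun_cons0.
Qed.

Lemma expect_ffun_cons (R : realFieldType) r (W : finType)
    (F : {ffun 'I_r.+1 -> W} -> R) :
  expect F = \E_(w : W) \E_(V : {ffun 'I_r -> W}) F (ffun_cons w V).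
Proof.
rewrite (expect_reindex _ (ffun_cons_bij r W)).
by rewrite -(expect_pair (fun w V => F (ffun_cons w V))).
Qed.

Definition mix (r : nat) (W : Type) (V0 V1 : {ffun 'I_r -> W})
  (b : {ffun 'I_r -> bool}) : {ffun 'I_r -> W} :=
  [ffun j => if b j then V1 j else V0 j].

Lemma mix_cons r (W : Type) (w0 w1 : W) (V0 V1 : {ffun 'I_r -> W}) c b :
  mix (ffun_cons w0 V0) (ffun_cons w1 V1) (ffun_cons c b) =
  ffun_cons (if c then w1 else w0) (mix V0 V1 b).
Proof.
apply/ffunP => i; case: (unliftP ord0 i) => [j|] ->.
  by rewrite ffunE !ffun_consS ffunE.
by rewrite ffunE !ffun_cons0.
Qed.

Lemma prod_cube_cons (R : comNzRingType) r (F : {ffun 'I_r.+1 -> bool} -> R) :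
  \prod_b F b =
  \prod_(b : {ffun 'I_r -> bool}) (F (ffun_cons false b) * F (ffun_cons true b)).
Proof.
rewrite (reindex (fun p : bool * {ffun 'I_r -> bool} => ffun_cons p.1 p.2)) /=;
  last exact: onW_bij (ffun_cons_bij _ _).
rewrite -(pair_bigA _ (fun c b => F (ffun_cons c b))) /= exchange_big /=.
by apply: eq_bigr => b _; rewrite big_bool mulrC.
Qed.

Definition agree_off (r : nat) (W : Type) (j : 'I_r) (V V' : {ffun 'I_r -> W}) :=
  forall i, i != j -> V i = V' i.

(* Each Cauchy-Schwarz step removes the factor that ignores one coordinate
   of [V], at the price of doubling that coordinate; the two copies join [y]
   for the remaining steps. *)
Lemma cauchy_schwarz_cube (R : realFieldType) (r : nat) (W Y : finType)
    (f : Y -> {ffun 'I_r -> W} -> R)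
    (chi : 'I_r -> Y -> {ffun 'I_r -> W} -> R) :
  (forall j y V, `|chi j y V| <= 1) ->
  (forall j y V V', agree_off j V V' -> chi j y V = chi j y V') ->
  (\E_(y : Y) \E_(V : {ffun 'I_r -> W}) (f y V * \prod_j chi j y V))
    ^+ (2 ^ r) <=
  \E_(y : Y) \E_(V0 : {ffun 'I_r -> W}) \E_(V1 : {ffun 'I_r -> W})
    \prod_b f y (mix V0 V1 b).
Proof.
elim: r Y f chi => [|r IH] Y f chi chi1 chiI.
  rewrite expr1 le_eqVlt; apply/orP; left; apply/eqP/eq_expect => y.
  apply: eq_expect => V0.
  have e0 (T : Type) (v w : {ffun 'I_0 -> T}) : v = w by apply/ffunP => -[].
  rewrite big_ord0 mulr1 (@eq_expect _ _ _ (fun=> f y V0)) ?(expect_cst V0) //.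
  move=> V1; rewrite (big_pred1 [ffun=> false]).
    by congr f; exact: e0.
  by move=> b; apply/esym/eqP; exact: e0.
pose f' (y : Y * (W * W)) V :=
  f y.1 (ffun_cons y.2.1 V) * f y.1 (ffun_cons y.2.2 V).
pose chi' j (y : Y * (W * W)) V :=
  chi (lift ord0 j) y.1 (ffun_cons y.2.1 V) *
  chi (lift ord0 j) y.1 (ffun_cons y.2.2 V).
have chi'1 j y V : `|chi' j y V| <= 1.
  by rewrite normrM mulr_ile1.
have chi'I j y V V' : agree_off j V V' -> chi' j y V = chi' j y V'.
  move=> VV'; congr (_ * _); apply: chiI => i;
    case: (unliftP ord0 i) => [i'|] ->; rewrite ?ffun_cons0 // !ffun_consS => ij;
    by apply: VV'; apply: contraNneq ij => ->.
have := IH _ f' chi' chi'1 chi'I.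
have -> : \E_(y : Y * (W * W)) \E_(V0 : {ffun 'I_r -> W})
            \E_(V1 : {ffun 'I_r -> W}) \prod_b f' y (mix V0 V1 b) =
  \E_(y : Y) \E_(V0 : {ffun 'I_r.+1 -> W}) \E_(V1 : {ffun 'I_r.+1 -> W})
    \prod_b f y (mix V0 V1 b).
  rewrite (expect_pair (fun y w => \E_(V0 : {ffun 'I_r -> W})
     \E_(V1 : {ffun 'I_r -> W}) \prod_b f' (y, w) (mix V0 V1 b))).
  apply: eq_expect => y.
  rewrite (expect_pair (fun w0 w1 => \E_(V0 : {ffun 'I_r -> W})
     \E_(V1 : {ffun 'I_r -> W}) \prod_b f' (y, (w0, w1)) (mix V0 V1 b))).
  rewrite expect_ffun_cons; apply: eq_expect => w0.
  rewrite expect_swap; apply: eq_expect => V0.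
  rewrite expect_ffun_cons; apply: eq_expect => w1.
  apply: eq_expect => V1; rewrite prod_cube_cons; apply: eq_bigr => b _.
  by rewrite !mix_cons.
pose g y V w := f y (ffun_cons w V) *
  \prod_j chi (lift ord0 j) y (ffun_cons w V).
have -> : \E_(y : Y * (W * W)) \E_(V : {ffun 'I_r -> W})
            (f' y V * \prod_j chi' j y V) =
          \E_(y : Y) \E_(V : {ffun 'I_r -> W}) expect (g y V) ^+ 2.
  rewrite (expect_pair (fun y w => \E_(V : {ffun 'I_r -> W})
     (f' (y, w) V * \prod_j chi' j (y, w) V))).
  apply: eq_expect => y; rewrite expect_swap; apply: eq_expect => V.
  rewrite (expect_pair (fun w0 w1 =>
     (f' (y, (w0, w1)) V * \prod_j chi' j (y, (w0, w1)) V))).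
  rewrite expr2 -expectZ; apply: eq_expect => w0.
  rewrite mulrC -expectZ; apply: eq_expect => w1.
  by rewrite /f' /chi' /g /= big_split /=; ring.
apply: le_trans.
rewrite expnS exprM lerXn2r ?nnegrE ?sqr_ge0 //.
  by do 2!apply: expect_ge0 => ?; exact: sqr_ge0.
apply: le_trans (expect_sqr_le _) _; apply: ler_expect => y.
have -> : \E_(V : {ffun 'I_r.+1 -> W}) (f y V * \prod_j chi j y V) =
    \E_(V : {ffun 'I_r -> W}) \E_(w : W)
      (f y (ffun_cons w V) * \prod_j chi j y (ffun_cons w V)).
  by rewrite expect_ffun_cons expect_swap.
apply: le_trans (expect_sqr_le _) _; apply: ler_expect => V.
case: (pickP W) => [w0 _|W0]; last first.
  by rewrite /expect eq_card0 // invr0 !mul0r.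
(* [chi ord0] ignores the coordinate [w], so it leaves this average; after squaring it is dropped,
   being at most 1 in absolute value. *)
have -> : \E_(w : W) (f y (ffun_cons w V) * \prod_j chi j y (ffun_cons w V)) =
    chi ord0 y (ffun_cons w0 V) * expect (g y V).
  rewrite -expectZ; apply: eq_expect => w; rewrite big_ord_recl /g.
  rewrite (chiI ord0 y (ffun_cons w V) (ffun_cons w0 V)); first by ring.
  move=> i; case: (unliftP ord0 i) => [j|] -> //.
  by rewrite !ffun_consS.
rewrite exprMn ler_piMl ?sqr_ge0 // -real_normK ?num_real //.
by rewrite exprn_ile1.
Qed.

(** * Pattern tensors of functions orthogonal to juntas *)

Definition fxor (T : finType) (x y : {ffun T -> bool}) : {ffun T -> bool} :=
  [ffun t => x t (+) y t].

(** For uniform [u], [fxor z (fmask A u)] is a uniform point of the subcube of points that agree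
    with [z] on [A]. *)
Definition fmask (T : finType) (A : {set T}) (u : {ffun T -> bool}) :
  {ffun T -> bool} := [ffun t => (t \notin A) && u t].

Lemma fxorK (T : finType) (y : {ffun T -> bool}) :
  involutive (fun x : {ffun T -> bool} => fxor x y).
Proof. by move=> x; apply/ffunP => t; rewrite !ffunE addbK. Qed.

Lemma card_fmask_fiber (T : finType) (A : {set T}) (z z' : {ffun T -> bool}) :
  (#|[pred u | fxor z (fmask A u) == z']| <= 2 ^ #|A|)%N.
Proof.
rewrite -card_powerset; set D := [pred u | _].
pose h (u : {ffun T -> bool}) := [set t in A | u t].
have hinj : {in D &, injective h}.
  move=> u v /eqP uz /eqP vz uv; apply/ffunP => t.
  have /setP/(_ t) := uv; rewrite !inE.
  have /ffunP/(_ t) : fxor z (fmask A u) = fxor z (fmask A v) by rewrite uz vz.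
  by rewrite !ffunE; case: (t \in A) => //= /addbI.
rewrite -(card_in_imset hinj) subset_leq_card //.
by apply/fintype.subsetP => _ /imsetP [u _ ->]; rewrite inE; apply/fintype.subsetP => t /setIdP[].
Qed.

(** Each value is taken for at most [2 ^ #|A|] of the [u], so passing from a subcube to the whole
    cube costs that factor. *)
Lemma expect_fmask_le (R : realFieldType) (T : finType) (A : {set T})
    (g : {ffun T -> bool} -> R) (z : {ffun T -> bool}) :
  (forall z, 0 <= g z) ->
  \E_(u : {ffun T -> bool}) g (fxor z (fmask A u)) <= 2 ^+ #|A| * expect g.
Proof.
move=> g0; rewrite /expect mulrCA ler_wpM2l ?invr_ge0 ?ler0n //.
rewrite (partition_big (fun u => fxor z (fmask A u)) predT) //= mulr_sumr.
apply: ler_sum => z' _.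
rewrite (eq_bigr (fun=> g z')) => [|u /eqP -> //].
rewrite sumr_const -[leLHS]mulr_natl ler_wpM2r //.
by rewrite -natrX ler_nat card_fmask_fiber.
Qed.

Definition read (I Q : finType) (x : {ffun I * Q -> bool}) (q : I -> Q) :
  {ffun I -> bool} := [ffun i => x (i, q i)].

(* The bits read in the rows outside [A] are independent, so they may be
   shifted by independent uniform strings. *)
Lemma expect_prod_read (R : realFieldType) (B I Q : finType) (A : {set I})
    (q : B -> I -> Q) (g : {ffun I -> bool} -> R) :
  (forall i, i \notin A -> injective (q^~ i)) ->
  \E_(x : {ffun I * Q -> bool}) \prod_b g (read x (q b)) =
  \E_(x : {ffun I * Q -> bool}) \prod_b
     \E_(u : {ffun I -> bool}) g (fxor (read x (q b)) (fmask A u)).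
Proof.
move=> qinj.
(* [s u] flips the cell [(i, q b i)] according to the bit [u b i], for [i] outside [A]; by
   injectivity no cell is claimed by two different [b]. Xoring with [s u] permutes the arrays, so
   the average over [x] does not change. *)
pose s (u : {ffun B -> {ffun I -> bool}}) : {ffun I * Q -> bool} :=
  [ffun p => (p.1 \notin A) && [exists b, (q b p.1 == p.2) && u b p.1]].
have sE x u b : read (fxor x (s u)) (q b) = fxor (read x (q b)) (fmask A (u b)).
  apply/ffunP => i; rewrite !ffunE /=; case: (boolP (i \in A)) => //= iA.
  congr (_ (+) _); apply/existsP/idP => [[b' /andP[/eqP/(qinj _ iA) ->]]//|ub].
  by exists b; rewrite eqxx.
transitivity (\E_(u : {ffun B -> {ffun I -> bool}})
    \E_(x : {ffun I * Q -> bool}) \prod_b g (read (fxor x (s u)) (q b))).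
  rewrite -[LHS](expect_cst ([ffun=> [ffun=> false]] : {ffun B -> {ffun I -> bool}})).
  apply: eq_expect => u; apply: expect_reindex.
  exact: inv_bij (fxorK (s u)).
rewrite expect_swap; apply: eq_expect => x.
rewrite -(expect_prod (fun b u => g (fxor (read x (q b)) (fmask A u)))).
by apply: eq_expect => u; apply: eq_bigr => b _; rewrite sE.
Qed.

Lemma fxor_bij (T : finType) (z : {ffun T -> bool}) :
  bijective (fun u : {ffun T -> bool} => fxor z (fmask finset.set0 u)).
Proof.
have K : involutive (fun u : {ffun T -> bool} => fxor z (fmask finset.set0 u)).
  by move=> u; apply/ffunP => t; rewrite !ffunE !inE /= addKb.
exact: inv_bij K.
Qed.

(** The case of a single read and an empty [A]: the string read is shifted by a uniform string, so
    it is uniform. *)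
Lemma expect_read (R : realFieldType) (I Q : finType) (q : I -> Q)
    (g : {ffun I -> bool} -> R) :
  \E_(x : {ffun I * Q -> bool}) g (read x q) = expect g.
Proof.
have H := @expect_prod_read R unit I Q finset.set0 (fun=> q) g.
transitivity (\E_(x : {ffun I * Q -> bool}) \prod_(b : unit) g (read x q)).
  by apply: eq_expect => x; rewrite (big_pred1 tt) // => -[].
rewrite H => [|i _ [] []//].
rewrite -[RHS](expect_cst ([ffun=> false] : {ffun I * Q -> bool})).
apply: eq_expect => x; rewrite (big_pred1 tt) => [|[]//].
by rewrite -(expect_reindex _ (fxor_bij _)).
Qed.

(** Orthogonality to functions of at most [D] coordinates, expressed by sums over the subcubes with
    at most [D] fixed coordinates. Each point of the subcube is counted [2 ^ #|A|] times. *)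
Definition junta_orthogonal (R : nmodType) (T : finType) (D : nat)
    (psi : {ffun T -> bool} -> R) : Prop :=
  forall (A : {set T}) z, (#|A| <= D)%N ->
    \sum_(u : {ffun T -> bool}) psi (fxor z (fmask A u)) = 0.

Definition collisions (r : nat) (I S : finType)
    (V0 V1 : {ffun 'I_r -> {ffun I -> S}}) : {set I} :=
  finset (fun i => [exists j, V0 j i == V1 j i]).

Definition addr_of (r : nat) (I S : finType) (V : {ffun 'I_r -> {ffun I -> S}})
    (i : I) : {ffun 'I_r -> S} := [ffun j => V j i].

Definition select (r : nat) (I S : finType)
    (x : {ffun I * {ffun 'I_r -> S} -> bool}) (V : {ffun 'I_r -> {ffun I -> S}}) :
  {ffun I -> bool} := read x (addr_of V).

(** * Correlation with products of functions that each ignore one argument *)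

Section Correlation.
Variables (R : realFieldType) (r D : nat) (I S : finType).
Variable psi : {ffun I -> bool} -> R.
Hypotheses (psiD : junta_orthogonal D psi) (psi1 : \E_(z : _) `|psi z| <= 1).
Local Notation Vs := {ffun 'I_r -> {ffun I -> S}}.
Local Notation Xs := {ffun I * {ffun 'I_r -> S} -> bool}.
Local Notation A := (2 ^+ (2 ^ r)%N : R).

Lemma addr_of_mix_inj (V0 V1 : Vs) i : i \notin collisions V0 V1 ->
  injective (fun b => addr_of (mix V0 V1 b) i).
Proof.
rewrite inE negb_exists => /forallP Vi b b' /ffunP bb'; apply/ffunP => j.
have := bb' j; rewrite !ffunE; have /eqP := Vi j.
by case: (b j); case: (b' j) => // ? /esym.
Qed.

(** After the random shift of the collision-free rows, each factor is an average of [psi] over a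
    subcube with at most [D] fixed coordinates, hence 0. *)
Lemma expect_cube_select_eq0 (V0 V1 : Vs) : (#|collisions V0 V1| <= D)%N ->
  \E_(x : Xs) \prod_b psi (select x (mix V0 V1 b)) = 0.
Proof.
move=> cD; rewrite (expect_prod_read _ (@addr_of_mix_inj V0 V1)).
rewrite /expect big1 ?mulr0 // => x _.
by rewrite (bigD1 [ffun=> false]) //= psiD // mulr0 mul0r.
Qed.

(** After the same shift, each of the [2 ^ r] factors is at most [2 ^ #|collisions V0 V1|] times the
    average of [|psi|] over the cube. *)
Lemma expect_cube_select_le (V0 V1 : Vs) :
  `|\E_(x : Xs) \prod_b psi (select x (mix V0 V1 b))| <=
  A ^+ #|collisions V0 V1|.
Proof.
apply: le_trans (ler_norm_expect _) _.
rewrite (@eq_expect _ _ _ (fun x => \prod_b `|psi (select x (mix V0 V1 b))|));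
  last by move=> x; rewrite normr_prod.
rewrite (expect_prod_read (fun z => `|psi z|) (@addr_of_mix_inj V0 V1)).
have A0 : 0 <= A ^+ #|collisions V0 V1| by rewrite !exprn_ge0.
apply: le_trans (expect_cst_le Xs A0).
apply: ler_expect => x.
have -> : A ^+ #|collisions V0 V1| =
    \prod_(b : {ffun 'I_r -> bool}) 2 ^+ #|collisions V0 V1|.
  by rewrite prodr_const card_ffun card_ord card_bool -!exprM mulnC.
apply: ler_prod => b _; rewrite expect_ge0 /=; last by move=> ?.
apply: le_trans (expect_fmask_le (collisions V0 V1)
  (read x (addr_of (mix V0 V1 b))) (fun z => normr_ge0 (psi z))) _.
by rewrite ler_piMr ?exprn_ge0.
Qed.

(* Markov's inequality for the moment generating function of the number of
   collisions, which is at most a sum of [r * #|I|] independent indicators of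
   probability [1 / #|S|]. *)
Lemma expect_collisions_le :
  \E_(V0 : Vs) \E_(V1 : Vs)
     (if (#|collisions V0 V1| <= D)%N then 0 else A ^+ #|collisions V0 V1|) <=
  4^-1 ^+ D.+1 * (1 + 4 * A / #|S|%:R) ^+ (#|I| * r).
Proof.
have A1 : 1 <= A by rewrite exprn_ege1 // ler1n.
have A4 : 1 <= 4 * A by lra.
(* A coincidence is charged [4 * A] instead of [A]: with more than [D] collisions the surplus
   factors 4 pay for [4^-1 ^+ D.+1]. *)
pose w (a a' : S) : R := if a == a' then 4 * A else 1.
have w1 a a' : 1 <= w a a' by rewrite /w; case: ifP.
have k0 : 0 <= 1 + 4 * A / #|S|%:R.
  by rewrite addr_ge0 // mulr_ge0 ?invr_ge0 //; lra.
have wE a : expect (w a) <= 1 + 4 * A / #|S|%:R.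
  rewrite (@eq_expect _ _ _ (fun a' => (4 * A - 1) * (a' == a)%:R + 1)).
    rewrite expectD (expect_cst a) expectZ addrC lerD2l.
    rewrite /expect (bigD1 a) //= eqxx big1 => [|a' /negPf-> //].
    by rewrite addr0 mulr1 ler_wpM2r ?invr_ge0 //; lra.
  by move=> a'; rewrite /w eq_sym; case: eqP => _ /=; ring.
apply: (@le_trans _ _ (\E_(V0 : Vs) \E_(V1 : Vs)
    (4^-1 ^+ D.+1 * \prod_j \prod_i w (V0 j i) (V1 j i)))).
  apply: ler_expect => V0; apply: ler_expect => V1.
  have w0 : 0 <= \prod_j \prod_i w (V0 j i) (V1 j i).
    by do 2![apply: prodr_ge0 => ? _]; apply: le_trans (w1 _ _).
  case: leqP => [_|cD]; first by rewrite mulr_ge0 ?exprn_ge0 ?invr_ge0.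
  rewrite exprVn ler_pdivlMl ?exprn_gt0 //.
  apply: (@le_trans _ _ ((4 * A) ^+ #|collisions V0 V1|)).
    rewrite exprMn ler_wpM2r ?exprn_ge0 //.
    by rewrite ler_weXn2l // ler1n.
  rewrite exchange_big -prodr_const [leLHS]big_mkcond /=; apply: ler_prod => i _.
  apply/andP; split; first by case: ifP => _; lra.
  case: ifP => [|_]; last first.
    rewrite -[leLHS](@big1_eq _ 1 *%R _ (index_enum 'I_r) predT).
    by apply: ler_prod => j _; rewrite ler01 w1.
  rewrite inE => /existsP [j Vj]; rewrite (bigD1 j) //= /w Vj ler_peMr //; first lra.
  rewrite -[leLHS](@big1_eq _ 1 *%R _ (index_enum 'I_r) (predC1 j)).
  by apply: ler_prod => j' _; rewrite ler01 w1.
have K0 : 0 <= 4^-1 ^+ D.+1 * (1 + 4 * A / #|S|%:R) ^+ (#|I| * r).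
  by rewrite mulr_ge0 ?exprn_ge0 ?invr_ge0.
apply: le_trans (expect_cst_le Vs K0).
apply: ler_expect => V0; rewrite expectZ ler_wpM2l ?exprn_ge0 ?invr_ge0 //.
rewrite (expect_prod (fun j (V : {ffun I -> S}) => \prod_i w (V0 j i) (V i))).
have -> : (1 + 4 * A / #|S|%:R) ^+ (#|I| * r) =
    \prod_(j : 'I_r) \prod_(i : I) (1 + 4 * A / #|S|%:R).
  by rewrite !prodr_const card_ord -exprM.
apply: ler_prod => j _; rewrite expect_ge0 /=; last first.
  by move=> V; apply: prodr_ge0 => i _; apply: le_trans (w1 _ _).
rewrite (expect_prod (fun i a => w (V0 j i) a)); apply: ler_prod => i _.
by rewrite wE expect_ge0 // => a; apply: le_trans (w1 _ _).
Qed.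

(** The factor [chi0] stays with [psi] during the Cauchy-Schwarz steps. As it does not depend on
    [x], its copies then leave the average over [x], and their product is at most 1 in absolute
    value. *)
Lemma correlation_le (chi0 : Vs -> R) (chi : 'I_r -> Xs -> Vs -> R) :
  (forall V, `|chi0 V| <= 1) -> (forall j x V, `|chi j x V| <= 1) ->
  (forall j x V V', agree_off j V V' -> chi j x V = chi j x V') ->
  (\E_(x : Xs) \E_(V : Vs) (psi (select x V) * (chi0 V * \prod_j chi j x V)))
    ^+ (2 ^ r) <=
  4^-1 ^+ D.+1 * (1 + 4 * A / #|S|%:R) ^+ (#|I| * r).
Proof.
move=> chi01 chi1 chiI; apply: le_trans expect_collisions_le.
have := cauchy_schwarz_cube (fun x V => psi (select x V) * chi0 V) chi1 chiI.
rewrite (@eq_expect _ Xs _ (fun x => \E_(V : Vs)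
    (psi (select x V) * (chi0 V * \prod_j chi j x V)))); last first.
  by move=> x; apply: eq_expect => V; rewrite mulrA.
move=> /le_trans; apply; rewrite expect_swap; apply: ler_expect => V0.
rewrite expect_swap; apply: ler_expect => V1.
rewrite (@eq_expect _ Xs _ (fun x => \prod_b chi0 (mix V0 V1 b) *
    \prod_b psi (select x (mix V0 V1 b)))); last first.
  by move=> x; rewrite -big_split; apply: eq_bigr => b _; rewrite mulrC.
rewrite expectZ; apply: le_trans (ler_norm _) _; rewrite normrM.
case: leqP => [cD|_]; first by rewrite expect_cube_select_eq0 // normr0 mulr0.
apply: le_trans (expect_cube_select_le V0 V1); rewrite ler_piMl //.
rewrite normr_prod -[leRHS](@big1_eq _ 1 *%R _ (index_enum {ffun 'I_r -> bool}) predT).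
by apply: ler_prod => b _; rewrite normr_ge0 chi01.
Qed.

End Correlation.

(** * A dual polynomial for OR *)

Section Dual.
Variables (R : realFieldType) (I : finType).
Local Notation cube := {ffun I -> bool}.
Implicit Types (A B : {set I}) (z u : cube).

Definition ones z : nat := #|[pred i | z i]|.

Definition sign z : R := \prod_i (-1) ^+ z i.

Definition vanish_on (L : seq nat) z : R :=
  \prod_(s <- L) (s%:R - (ones z)%:R).

Definition flip (i0 : I) : cube := [ffun i => i == i0].

Lemma sign_flip z i0 : sign (fxor z (flip i0)) = - sign z.
Proof.
rewrite /sign (bigD1 i0) //= [in RHS](bigD1 i0) //= !ffunE eqxx -mulNr.
congr (_ * _); first by case: (z i0); rewrite ?expr0 ?expr1 ?opprK.
by apply: eq_bigr => i /negPf ii0; rewrite !ffunE ii0 addbF.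
Qed.

(** Flipping the free coordinate [i0] permutes the terms, reverses [sign] and preserves [J], so the
    sum is its own negative. *)
Lemma sum_sign_junta_eq0 A B (J : cube -> R) z i0 :
  i0 \notin A -> i0 \notin B ->
  (forall z z', {in B, z =1 z'} -> J z = J z') ->
  \sum_u sign (fxor z (fmask A u)) * J (fxor z (fmask A u)) = 0.
Proof.
move=> iA iB JB; set X := \sum_u _.
have E : X = - X.
  rewrite {1}/X (reindex_inj (inv_inj (fxorK (flip i0)))) /= -sumrN.
  apply: eq_bigr => u _.
  have -> : fxor z (fmask A (fxor u (flip i0))) =
            fxor (fxor z (fmask A u)) (flip i0).
    apply/ffunP => i; rewrite !ffunE -!addbA; congr (_ (+) _).
    by case: eqP => [->|_]; rewrite ?iA ?addbF.
  rewrite sign_flip mulNr; congr (- (_ * _)); apply: JB => i iB'.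
  by rewrite ffunE [flip _ _]ffunE; case: eqP iB iB' => [-> /negPf->|]; rewrite ?addbF.
by lra.
Qed.

(** A factor [s - ones z] expands into a constant and single coordinates. Each term absorbs at most
    one more coordinate into the junta [J] while [L] loses an element, so the size condition
    persists until some coordinate is left free. *)
Lemma sum_sign_vanish_on_eq0 A B (J : cube -> R) z (L : seq nat) :
  (forall z z', {in B, z =1 z'} -> J z = J z') ->
  (#|A| + #|B| + size L < #|I|)%N ->
  \sum_u sign (fxor z (fmask A u)) *
     (J (fxor z (fmask A u)) * vanish_on L (fxor z (fmask A u))) = 0.
Proof.
elim: L B J => [|s L IH] B J JB /= lt.
  have [i0] : exists i0, i0 \in ~: (A :|: B).
    apply/card_gt0P; rewrite -(ltn_add2l #|A :|: B|) addn0 cardsC.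
    by apply: leq_ltn_trans lt; rewrite addn0 cardsU leq_subr.
  rewrite !inE negb_or => /andP[iA iB].
  rewrite -[RHS](@sum_sign_junta_eq0 A B J z i0 iA iB JB).
  by apply: eq_bigr => u _; rewrite /vanish_on big_nil mulr1.
have onesE z' : (ones z')%:R = \sum_i (z' i)%:R :> R.
  rewrite /ones -sum1_card natr_sum big_mkcond; apply: eq_bigr => i _.
  by rewrite unfold_in /=; case: (z' i).
pose F (J : cube -> R) u := sign (fxor z (fmask A u)) *
     (J (fxor z (fmask A u)) * vanish_on L (fxor z (fmask A u))).
transitivity (\sum_u (F (fun z => s%:R * J z) u -
                      \sum_i F (fun z => (z i)%:R * J z) u)).
  apply: eq_bigr => u _; rewrite /F; set x := fxor z _.
  rewrite {1}/vanish_on big_cons -/(vanish_on L x) onesE.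
  rewrite -mulr_sumr -mulr_suml -mulr_suml.
  by move: (\sum_i _) (sign x) (J x) (vanish_on L x) s%:R => a b c d e; ring.
have H1 : \sum_u F (fun z => s%:R * J z) u = 0.
  apply: (IH B (fun z => s%:R * J z)); last first.
    by move: lt; rewrite addnS => /ltnW.
  by move=> z1 z2 /JB ->.
rewrite sumrB {}H1 exchange_big /= big1 ?subr0 // => i _.
apply: (IH (i |: B) (fun z => (z i)%:R * J z)).
  move=> z1 z2 e; congr (_ * _); first by rewrite e // setU11.
  by apply: JB => j jB; apply: e; rewrite inE jB orbT.
rewrite cardsU1; apply: leq_ltn_trans lt; rewrite addnS -addSn leq_add2r.
by rewrite -addnS leq_add2l -add1n leq_add2r leq_b1.
Qed.

Lemma junta_orthogonal_dual (D : nat) (L : seq nat) (a : R) :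
  (D + size L < #|I|)%N ->
  junta_orthogonal D (fun z => a * (sign z * vanish_on L z)).
Proof.
move=> lt A z cA; rewrite -mulr_sumr -[RHS](mulr0 a); congr (_ * _).
rewrite -[RHS](@sum_sign_vanish_on_eq0 A finset.set0 (fun=> 1) z L) //.
  by apply: eq_bigr => u _; rewrite mul1r.
by rewrite cards0 addn0; apply: leq_ltn_trans lt; rewrite leq_add2r.
Qed.

Lemma norm_sign z : `|sign z| = 1.
Proof.
by rewrite normr_prod big1 // => i _; rewrite normrX normrN1 expr1n.
Qed.

Lemma sum_ones (f : nat -> R) :
  \sum_z f (ones z) = \sum_(0 <= t < #|I|.+1) 'C(#|I|, t)%:R * f t.
Proof.
rewrite (partition_big (fun z => inord (ones z) : 'I_#|I|.+1) predT) //=.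
rewrite big_mkord; apply: eq_bigr => t _.
have onesK z : (ones z < #|I|.+1)%N by rewrite ltnS max_card.
rewrite (eq_bigr (fun=> f t)) => [|z /eqP <-]; last by rewrite inordK.
pose h (A : {set I}) : cube := [ffun i => i \in A].
have hK : cancel h (fun z : cube => finset z).
  by move=> A; apply/setP => i; rewrite inE ffunE.
have hK' : cancel (fun z : cube => finset z) h.
  by move=> z; apply/ffunP => i; rewrite ffunE inE.
rewrite sumr_const -[LHS]mulr_natl; congr (_%:R * _).
rewrite -card_draws -(card_imset _ (can_inj hK')); apply: eq_card => A.
apply/imsetP/idP => [[z zt ->]|].
  have {}zt : ones z = t.
    by move: zt; rewrite unfold_in => /eqP e; rewrite -e /= inordK.
  rewrite inE; apply/eqP; transitivity (ones z); last exact: zt.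
  by apply: eq_card => i; rewrite inE.
rewrite inE => /eqP cA; exists (h A); last by rewrite hK.
rewrite unfold_in; apply/eqP; rewrite /= inordK // -cA.
by apply: eq_card => i; rewrite unfold_in /= ffunE.
Qed.

End Dual.

(** * Products of distances between the nodes *)

Section Nodes.
Variable R : realFieldType.

(* The squares alone would only give the origin a share of order
   [1 / sqrt D] in the L1 norm; the extra node 2 makes the weights of the other
   nodes summable. *)
Definition nodes (D : nat) : seq nat :=
  2%N :: [seq (i ^ 2)%N | i <- index_iota 0 D.+1].

(** For a duplicate-free [A] containing [t], this is the absolute value at [t] of the derivative of
    the monic polynomial with root set [A]: the Lagrange denominator. *)
Definition gap (A : seq nat) (t : nat) : R :=
  \prod_(s <- A | s != t) `|s%:R - t%:R|.

Lemma gap_gt0 A t : 0 < gap A t.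
Proof. by apply: prodr_gt0 => s st; rewrite normr_gt0 subr_eq0 eqr_nat. Qed.

Lemma prod_dist_below t : \prod_(0 <= s < t) `|s%:R - t%:R| = t`!%:R :> R.
Proof.
elim: t => [|t IH]; first by rewrite big_nil.
rewrite big_nat_recl //= factS natrM -IH sub0r normrN normr_nat.
by congr (_ * _); apply: eq_bigr => s _; rewrite -!natr1 opprD addrACA subrr addr0.
Qed.

Lemma gap_iota m t : (t <= m)%N ->
  gap (index_iota 0 m.+1) t = (t`! * (m - t)`!)%:R.
Proof.
move=> /subnKC <-; elim: (m - t)%N => {m} [|p IH]; rewrite /gap.
  rewrite addn0 subnn muln1 big_mkcond big_nat_recr //= eqxx mulr1.
  rewrite -prod_dist_below -big_mkcond big_nat_cond [RHS]big_nat_cond.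
  by apply: eq_bigl => s /=; case: (ltngtP s t); rewrite ?andbF.
rewrite addnS big_mkcond big_nat_recr //= -big_mkcond -/(gap _ _) IH.
have -> : ((t + p).+1 != t)%N by lia.
rewrite -addnS !addKn factS mulnCA [RHS]natrM [RHS]mulrC; congr (_ * _).
by rewrite natrD addrAC subrr add0r normr_nat.
Qed.

(** The factors [(i.+1 - j) * (i.+1 + j)] multiply to a quotient of factorials, stated here without
    division. *)
Lemma prod_square_dist_below i t : (t <= i.+1)%N ->
  (\prod_(0 <= j < t) `|(j ^ 2)%:R - (i.+1 ^ 2)%:R|) * (i.+1 - t)`!%:R =
  (i.+1 * (i + t)`!)%:R :> R.
Proof.
elim: t => [_|t IH ti].
  by rewrite big_nil mul1r addn0 subn0 factS.
have d : `|(t ^ 2)%:R - (i.+1 ^ 2)%:R| = ((i - t).+1 * (i + t).+1)%:R :> R.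
  rewrite ltnS in ti; rewrite distrC -natrB; last by rewrite leq_exp2r // leqW.
  by rewrite normr_nat subn_sqr subSn // addSn.
rewrite big_nat_recr //= d subSS addnS factS mulnCA [RHS]natrM -IH ?(ltnW ti) //.
rewrite subSn // factS !natrM; set P := \prod_(_ <= _ < _) _.
by move: P _%:R _%:R (_`!)%:R => a b e f; ring.
Qed.

Lemma prod_square_dist i D : (0 < i <= D)%N ->
  2 * \prod_(0 <= j < D.+1 | j != i) `|(j ^ 2)%:R - (i ^ 2)%:R| =
  ((D - i)`! * (D + i)`!)%:R :> R.
Proof.
case: i => // i /subnKC <-; elim: (D - i.+1)%N => {D} [|p IH].
  rewrite addn0 subnn big_mkcond big_nat_recr //= eqxx mulr1.
  have := @prod_square_dist_below i i.+1 (leqnn _); rewrite subnn mulr1.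
  rewrite big_nat_cond => e.
  rewrite -big_mkcond big_nat_cond (eq_bigl (fun j => (0 <= j < i.+1) && true)%N).
    rewrite e -natrM fact0 mul1n [(i.+1 + i.+1)%N]addSn factS mulnA.
    by congr (_ * _)%:R; lia.
  by move=> j /=; case: (ltngtP j i.+1); rewrite ?andbF.
rewrite addnS big_mkcond big_nat_recr //= -big_mkcond mulrA IH.
have -> : ((i.+1 + p).+1 != i.+1)%N by lia.
have -> : `|((i.+1 + p).+1 ^ 2)%:R - (i.+1 ^ 2)%:R| =
    (p.+1 * (i.+1 + p + i.+1).+1)%:R :> R.
  rewrite -natrB; last by rewrite leq_exp2r //; lia.
  by rewrite normr_nat subn_sqr; congr (_ * _)%:R; lia.
have -> : ((i.+1 + p).+1 - i.+1 = p.+1)%N by lia.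
have -> : (i.+1 + p - i.+1 = p)%N by lia.
rewrite [((i.+1 + p).+1 + i.+1)%N]addSn [p.+1`!]factS.
rewrite [(i.+1 + p + i.+1).+1`!]factS -natrM.
by congr _%:R; rewrite mulnACA [(p`! * _)%N]mulnC [(_`! * _.+1)%N]mulnC.
Qed.

(** Raising [i] by one trades a factor [D - i] for the larger [D + i + 1]. *)
Lemma fact_sqr_le D i : (i <= D)%N -> (D`! ^ 2 <= (D - i)`! * (D + i)`!)%N.
Proof.
elim: i => [|i IH] iD; first by rewrite subn0 addn0 expnS expn1.
apply: leq_trans (IH (ltnW iD)) _.
have -> : (D - i = (D - i.+1).+1)%N by lia.
rewrite addnS !factS [((D - i.+1).+1 * _)%N]mulnC -mulnA leq_mul2l leq_mul2r.
by apply/orP; right; apply/orP; right; lia.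
Qed.

(** Only the lower bound [1 / 6] for the product of the [1 - 2 / i ^ 2] is wanted; the extra ratio
    [(D + 4) / D], with equality at [D = 2], makes the induction go through. *)
Lemma prod_square_sub2_ge D : (2 <= D)%N ->
  (\prod_(2 <= i < D.+1) (i ^ 2)%:R) * (D + 4)%:R <=
  (6 * D)%:R * \prod_(2 <= i < D.+1) ((i ^ 2)%:R - 2) :> R.
Proof.
case: D => [|[|D]] // _; elim: D => [|D IH].
  by rewrite !big_nat1 -natrM -natrB // -natrM ler_nat.
rewrite big_nat_recr //= [in leRHS]big_nat_recr //=.
set P := \prod_(_ <= _ < _) _ in IH *; set Q := \prod_(_ <= _ < _) _ in IH *.
have Q0 : 0 <= Q.
  rewrite /Q big_nat_cond; apply: prodr_ge0 => i /andP[/andP[i2 _] _].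
  by rewrite subr_ge0 ler_nat; nia.
rewrite -(ler_pM2r (_ : 0 < (D.+2 + 4)%:R)) ?ltr0n ?addn4 //.
have := ler_wpM2r (_ : 0 <= (D.+3 ^ 2 * (D.+3 + 4))%:R) IH.
move=> /(_ (ler0n _ _)) H.
apply: le_trans (_ : P * (D.+2 + 4)%:R * (D.+3 ^ 2 * (D.+3 + 4))%:R <= _).
  by rewrite addn4 natrM le_eqVlt; apply/orP; left; apply/eqP; ring.
apply: le_trans H _.
rewrite -!natrB; last by nia.
rewrite [leLHS]mulrAC [in leRHS]mulrA [in leRHS](mulrAC _ Q) [in leRHS](mulrAC _ Q).
by rewrite ler_wpM2r // -!natrM ler_nat; nia.
Qed.

(** Telescoping: for [n >= 2], [1 / (n ^ 2 - 2)] is at most [1 / (n - 1) - 1 / n], and the term of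
    index 1 equals 1. *)
Lemma sum_inv_square_sub2_le D : (1 <= D)%N ->
  \sum_(1 <= i < D.+1) `|2 - (i ^ 2)%:R|^-1 <= 2 - D%:R^-1 :> R.
Proof.
case: D => // D _; elim: D => [|D IH].
  by rewrite big_nat1; rewrite (_ : 2 - _ = 1) ?normr1 ?invr1; lra.
rewrite big_nat_recr //=; apply: le_trans (lerD IH (lexx _)) _.
rewrite -lerBrDl -[leLHS]div1r ler_pdivrMr; last first.
  by rewrite normr_gt0 subr_eq0 eqr_nat; nia.
rewrite distrC ger0_norm; last by rewrite subr_ge0 ler_nat; nia.
have d0 : 0 <= D%:R :> R by [].
have -> : 2 - D.+2%:R^-1 - (2 - D.+1%:R^-1) = (D.+1%:R * D.+2%:R)^-1 :> R.
  by rewrite -!natr1; field; lra.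
rewrite ler_pdivlMl ?mulr1 -?natrM ?ltr0n // -natrB ?ler_nat; nia.
Qed.

(** Up to a common factor the inverse gaps are the L1 masses of the levels of the dual polynomial,
    so this gives the origin a share of at least [1 / 15]. The constant is 6 for the node 2, 1 for
    the node 0 and 8 for the other squares. *)
Lemma sum_inv_gap_le D : (1 <= D)%N ->
  \sum_(t <- nodes D) (gap (nodes D) t)^-1 <= 15 / gap (nodes D) 0.
Proof.
move=> D1.
have F0 : 0 < (D`! ^ 2)%:R :> R by rewrite ltr0n expn_gt0 fact_gt0.
have prodE : (D`! ^ 2)%:R = \prod_(1 <= i < D.+1) (i ^ 2)%:R :> R.
  by rewrite fact_prod -natr_prod; congr _%:R; rewrite big_nat_cond
     [in RHS]big_nat_cond -(big_morph _ (fun x y => expnMn x y 2) (exp1n 2)).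
have gap0 : gap (nodes D) 0 = 2 * (D`! ^ 2)%:R.
  rewrite /gap big_cons big_map subr0 normr_nat; congr (_ * _).
  rewrite big_mkcond big_nat_recl //= mul1r prodE big_add1 /=.
  by apply: eq_bigr => i _; rewrite ?expn_eq0 subr0 normr_nat.
(* The distances to the other squares multiply to at least half the square of the factorial of [D],
   and the node 2 supplies the summable factor. *)
have gapS i : (0 < i <= D)%N ->
    (gap (nodes D) (i ^ 2))^-1 <= 4 * `|2 - (i ^ 2)%:R|^-1 / gap (nodes D) 0.
  move=> iD; have n2 : (2 != i ^ 2)%N by case: i {iD} => [|[|i]] //; nia.
  have n20 : 0 < `|2 - (i ^ 2)%:R| :> R by rewrite normr_gt0 subr_eq0 eqr_nat.
  rewrite gap0 /gap big_cons n2 big_map (eq_bigl (fun j => j != i));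
    last by move=> j; rewrite eqn_exp2r.
  have := prod_square_dist iD.
  have : (D`! ^ 2)%:R <= ((D - i)`! * (D + i)`!)%:R :> R.
    by rewrite ler_nat fact_sqr_le //; case/andP: iD.
  move=> + H; rewrite -H; move: F0 n20.
  move: `|_| (\prod_(_ <- _ | _) _) (_%:R : R) => a P f f0 a0 fP.
  have P0 : 0 < P by lra.
  rewrite invfM (_ : 4 * a^-1 / (2 * f) = a^-1 * (2 / f)); last first.
    by field; rewrite !gt_eqF.
  rewrite ler_pM2l ?invr_gt0 // -[leLHS]div1r ler_pdivrMr // mulrAC ler_pdivlMr //.
  by rewrite mul1r.
have gap2 : (gap (nodes D) 2)^-1 <= 6 / gap (nodes D) 0.
  rewrite gap0 /gap big_cons big_map eqxx (eq_bigl predT); last first.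
    by case=> [|[|i]] //=; apply/eqP; nia.
  rewrite big_nat_recl //= sub0r normrN normr_nat.
  have -> : \prod_(0 <= i < D) `|(i.+1 ^ 2)%:R - 2%:R| =
            \prod_(1 <= i < D.+1) `|(i ^ 2)%:R - 2| :> R by rewrite big_add1.
  rewrite big_ltn //.
  rewrite (_ : `|(1 ^ 2)%:R - 2%:R| = 1); last first.
    by rewrite distrC -natrB // normr1.
  rewrite mul1r.
  rewrite (eq_big_nat _ _ (F2 := fun i => (i ^ 2)%:R - 2)); last first.
    by move=> i i2; rewrite ger0_norm // subr_ge0 ler_nat; nia.
  move: D1; rewrite leq_eqVlt => /predU1P [<-|D2].
    by rewrite big_geq // mulr1; lra.
  rewrite prodE [\prod_(1 <= _ < _) _]big_ltn ?ltnS ?(ltnW D2) // exp1n mul1r.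
  have := prod_square_sub2_ge D2.
  set P := \prod_(_ <= _ < _) _; set Q := \prod_(_ <= _ < _) _ => PQ.
  have P0 : 0 < P by rewrite /P big_nat_cond prodr_gt0 // => i; rewrite ltr0n; nia.
  have D0 : 0 < D%:R :> R by rewrite ltr0n ltnW.
  have PQ' : P <= 6 * Q.
    rewrite -(ler_pM2r D0); apply: le_trans (_ : P * (D + 4)%:R <= _).
      by rewrite ler_pM2l // ler_nat leq_addr.
    by rewrite mulrAC -natrM.
  have Q0 : 0 < Q by lra.
  have p0 : 0 < 2 * P by rewrite mulr_gt0.
  have q0 : 0 < 2 * Q by rewrite mulr_gt0.
  by rewrite -[leLHS]div1r ler_pdivrMr // mulrAC ler_pdivlMr // mul1r mulrCA ler_pM2l.
rewrite {1}/nodes big_cons big_map big_nat_recl //=.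
have s0 : \sum_(0 <= i < D) (gap (nodes D) (i.+1 ^ 2))^-1 <=
    8 / gap (nodes D) 0.
  apply: (@le_trans _ _ (4 / gap (nodes D) 0 *
     \sum_(1 <= i < D.+1) `|2 - (i ^ 2)%:R|^-1)).
    rewrite big_add1 /= mulr_sumr big_nat_cond [leRHS]big_nat_cond.
    apply: ler_sum => i /andP[/andP[_ iD] _].
    by rewrite mulrAC; exact: gapS.
  have := sum_inv_square_sub2_le D1; have : 0 <= D%:R^-1 :> R by rewrite invr_ge0.
  move=> d0 sD; rewrite (_ : 8 / _ = 4 / gap (nodes D) 0 * 2); last by lra.
  by rewrite ler_wpM2l ?divr_ge0 ?(ltW (gap_gt0 _ _)) //; lra.
rewrite (_ : 15 / _ = 6 / gap (nodes D) 0 + ((gap (nodes D) 0)^-1 +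
  8 / gap (nodes D) 0)); last by lra.
by rewrite lerD // lerD.
Qed.

End Nodes.

Lemma nodes_uniq D : uniq (nodes D).
Proof.
rewrite /nodes cons_uniq map_inj_uniq ?iota_uniq ?andbT; last first.
  by move=> i j /eqP; rewrite eqn_exp2r // => /eqP.
by apply/mapP => -[[|[|i]] _]; nia.
Qed.

Lemma nodes_le D m t : (1 < m)%N -> (D ^ 2 <= m)%N -> t \in nodes D -> (t <= m)%N.
Proof.
move=> m2 Dm; rewrite inE => /predU1P [-> //|/mapP [i]].
rewrite mem_index_iota /= ltnS => iD ->; apply: leq_trans Dm.
by rewrite leq_exp2r.
Qed.

(** * The dual polynomial, supported on the levels in [nodes D] *)

Section DualOR.
Variables (R : realFieldType) (I : finType) (D : nat).
Hypotheses (D1 : (1 <= D)%N) (I2 : (1 < #|I|)%N) (DI : (D ^ 2 <= #|I|)%N).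

Definition others : seq nat := [seq s <- index_iota 0 #|I|.+1 | s \notin nodes D].

Lemma perm_nodes : perm_eq (index_iota 0 #|I|.+1) (nodes D ++ others).
Proof.
apply: uniq_perm; first exact: iota_uniq.
  rewrite cat_uniq nodes_uniq filter_uniq ?iota_uniq // andbT.
  by apply/hasPn => s; rewrite mem_filter => /andP[].
move=> s; rewrite mem_cat mem_filter mem_index_iota /= ltnS.
by case: (boolP (s \in nodes D)) => //= /nodes_le ->.
Qed.

(** There are [D + 2] nodes among the [#|I| + 1] levels, exactly as many as [junta_orthogonal_dual]
    requires. *)
Lemma size_others : (D + size others < #|I|)%N.
Proof.
have := perm_size perm_nodes; rewrite size_cat size_iota.
rewrite /nodes [size (_ :: _)]/= size_map size_iota subn0.
by case=> ->.
Qed.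

Lemma norm_vanish_on_others (z : {ffun I -> bool}) :
  `|vanish_on R others z| =
  \prod_(s <- others) `|s%:R - (ones z)%:R|.
Proof. by rewrite normr_prod. Qed.

Definition weight (t : nat) : R := \prod_(s <- others) `|s%:R - t%:R|.

Lemma weight_other t : t \in others -> weight t = 0.
Proof. by move=> tL; rewrite /weight (big_rem t) //= subrr normr0 mul0r. Qed.

(** Among all levels the gap of [t] is the product of the factorials of [t] and [#|I| - t]; it
    splits into the gap among the nodes and [weight t]. *)
Lemma bin_weight t : t \in nodes D ->
  'C(#|I|, t)%:R * weight t = (#|I|)`!%:R / gap R (nodes D) t.
Proof.
move=> tS; have tI := nodes_le I2 DI tS.
have := gap_iota R tI; rewrite /gap (perm_big _ perm_nodes) big_cat /=.
rewrite -!/(gap _ _ _) => e.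
have -> : weight t = gap R others t.
  rewrite /gap /weight big_seq [RHS]big_seq_cond; apply: eq_bigl => s.
  case: (boolP (s \in others)) => //=; rewrite mem_filter => /andP[sS _].
  by apply/esym; apply: contraNneq sS => ->.
rewrite -(bin_fact tI) natrM -e -[in RHS]mulrA.
by rewrite mulrAC divff ?mul1r ?gt_eqF ?gap_gt0.
Qed.

Lemma dual_OR : exists psi : {ffun I -> bool} -> R,
  [/\ junta_orthogonal D psi, \E_(z : {ffun I -> bool}) `|psi z| <= 1 &
      15^-1 <= 2^-1 ^+ #|I| * psi [ffun=> false]].
Proof.
pose phi (z : {ffun I -> bool}) := sign R z * vanish_on R others z.
have o0 : ones ([ffun=> false] : {ffun I -> bool}) = 0%N.
  by apply: eq_card0 => i; rewrite inE /= ffunE.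
have phi0 : phi [ffun=> false] = weight 0.
  rewrite /phi /sign big1 ?mul1r => [|i _]; last by rewrite ffunE expr0.
  by rewrite /vanish_on o0; apply: eq_bigr => s _; rewrite subr0 normr_nat.
have sumE : \sum_z `|phi z| <= 15 * phi [ffun=> false].
  rewrite (eq_bigr (fun z => weight (ones z))); last first.
    by move=> z _; rewrite normrM norm_sign mul1r norm_vanish_on_others.
  rewrite sum_ones (perm_big _ perm_nodes) big_cat /= [X in _ + X]big_seq.
  rewrite [X in _ + X]big1 ?addr0; last first.
    by move=> t /weight_other ->; rewrite mulr0.
  rewrite big_seq (eq_bigr (fun t => (#|I|)`!%:R / gap R (nodes D) t)); last first.
    by move=> t; exact: bin_weight.
  rewrite -big_seq -mulr_sumr phi0.
  have := @bin_weight 0; rewrite bin0 mul1r => ->; last first.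
    by rewrite inE; apply/orP; right; apply/mapP; exists 0%N.
  by rewrite mulrCA ler_wpM2l ?sum_inv_gap_le.
have phi0_gt0 : 0 < phi [ffun=> false].
  rewrite phi0; have := @bin_weight 0; rewrite bin0 mul1r => ->.
    by rewrite divr_gt0 ?gap_gt0 ?ltr0n ?fact_gt0.
  by rewrite inE; apply/orP; right; apply/mapP; exists 0%N.
pose S := \sum_z `|phi z|.
have S0 : 0 < S.
  apply: lt_le_trans phi0_gt0 _; rewrite /S (bigD1 [ffun=> false]) //=.
  by apply: ler_wpDr; [exact: sumr_ge0 | exact: ler_norm].
(* This scaling makes the average of [|psi|] exactly 1. *)
pose a := 2 ^+ #|I| / S.
have a0 : 0 < a by rewrite divr_gt0 // exprn_gt0.
have cube0 : 2 ^+ #|I| != 0 :> R by rewrite expf_neq0 ?pnatr_eq0.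
exists (fun z => a * phi z); split.
- exact: junta_orthogonal_dual size_others.
- rewrite /expect (eq_bigr (fun z => a * `|phi z|)) => [|z _]; last first.
    by rewrite normrM gtr0_norm.
  rewrite -mulr_sumr card_ffun card_bool natrX -/S /a mulrA mulrA mulVf //.
  by rewrite mul1r mulVf // gt_eqF.
- rewrite /a exprVn mulrA [_^-1 * (_ / _)]mulrA mulVf // mul1r mulrC ler_pdivlMr //.
  by rewrite mulrC ler_pdivrMr // mulrC.
Qed.

End DualOR.

(** * Protocols *)

Section Protocols.
Variables (R : realType) (k N m : nat).
Local Notation r := k.-1.
Local Notation n := (N %/ m)%N.
Local Notation arg := (@pattern_arg k N m).
Local Notation Vs := {ffun 'I_r -> {ffun 'I_m -> 'I_n}}.
Local Notation Xs := {ffun 'I_m * {ffun 'I_r -> 'I_n} -> bool}.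

Definition input (x : Xs) (V : Vs) : forall i, arg i :=
  fun i => match i with None => x | Some j => V j end.

Lemma pattern_tensor_input (phi : {ffun 'I_m -> bool} -> R) x V :
  pattern_tensor phi (input x V) = phi (select x V).
Proof.
by rewrite /pattern_tensor; congr phi; apply/ffunP => i; rewrite !ffunE.
Qed.

Lemma input_view_None x x' V :
  (fun j : {j : option 'I_r | j != None} => input x V (val j)) =
  (fun j => input x' V (val j)).
Proof. by apply: functional_extensionality_dep => -[[j|]]. Qed.

Lemma input_view_Some x V V' j0 : agree_off j0 V V' ->
  (fun j : {j : option 'I_r | j != Some j0} => input x V (val j)) =
  (fun j => input x V' (val j)).
Proof.
by move=> VV'; apply: functional_extensionality_dep => -[[j|] ij] //=; apply: VV'.
Qed.

(* Generalized cylinder intersections: products of functions bounded by 1,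
   one per player, each depending only on what that player sees. *)
Definition cylinder (chi : Xs -> Vs -> R) : Prop :=
  exists (chi0 : Vs -> R) (chij : 'I_r -> Xs -> Vs -> R),
    [/\ forall V, `|chi0 V| <= 1, forall j x V, `|chij j x V| <= 1,
        forall j x V V', agree_off j V V' -> chij j x V = chij j x V' &
        forall x V, chi x V = chi0 V * \prod_j chij j x V].

Definition correlation (Psi chi : Xs -> Vs -> R) : R :=
  \E_(x : Xs) \E_(V : Vs) (Psi x V * chi x V).

Lemma cylinder1 : cylinder (fun _ _ => 1).
Proof.
exists (fun=> 1), (fun _ _ _ => 1); split=> *; rewrite ?normr1 //.
by rewrite big1 ?mulr1.
Qed.

Lemma cylinder_view (chi : Xs -> Vs -> R) (i : option 'I_r)
    (f : view (fun i => arg i) i -> R) :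
  (forall v, `|f v| <= 1) -> cylinder chi ->
  cylinder (fun x V => f (fun j => input x V (val j)) * chi x V).
Proof.
move=> f1 [chi0 [chij [c0 c1 cI cE]]]; case: i f f1 => [j0|] f f1; last first.
  (* Player [None] does not see the array, so any fixed array can stand in for it. *)
  pose x0 : Xs := [ffun=> false].
  exists (fun V => f (fun j => input x0 V (val j)) * chi0 V), chij; split=> //.
    by move=> V; rewrite normrM mulr_ile1.
  by move=> x V; rewrite cE mulrA (input_view_None x x0).
exists chi0, (fun j x V => (if j == j0 then f (fun j => input x V (val j)) else 1)
                           * chij j x V); split=> //.
- by move=> j x V; rewrite normrM mulr_ile1 //; case: ifP; rewrite ?normr1.
- move=> j x V V' VV'; rewrite (cI j x V V') //; congr (_ * _).
  by case: eqP => // jj; rewrite (@input_view_Some x V V') // -jj.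
- move=> x V; rewrite cE mulrCA; congr (_ * _); rewrite big_split /=; congr (_ * _).
  rewrite (bigD1 j0) //= eqxx big1 ?mulr1 // => j /negPf -> //.
Qed.

(** A node splits the acceptance indicator in two, each part carrying a function of the speaker's
    view that [cylinder_view] absorbs into [chi]. There are at most [2 ^+ cost p] leaves, and each
    contributes at most [delta]. *)
Lemma correlation_run_le (Psi : Xs -> Vs -> R) (delta : R)
    (p : protocol (fun i => arg i)) chi :
  (forall chi, cylinder chi -> `|correlation Psi chi| <= delta) ->
  cylinder chi ->
  `|correlation Psi (fun x V => (run p (input x V))%:R * chi x V)| <=
  2 ^+ cost p * delta.
Proof.
move=> Pd; elim: p chi => [b|i f p0 IH0 p1 IH1] chi cchi.
  rewrite /= expr0 mul1r; case: b.
    rewrite /correlation (@eq_expect _ _ _ (fun x => \E_(V : Vs) (Psi x V * chi x V))).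
      exact: Pd.
    by move=> x; apply: eq_expect => V; rewrite mul1r.
  apply: le_trans (_ : 0 <= delta); last by apply: le_trans (Pd _ cchi).
  rewrite /correlation (@eq_expect _ _ _ (fun=> 0)) => [|x]; last first.
    by rewrite /expect big1 ?mulr0 // => V _; rewrite mul0r mulr0.
  by rewrite /expect big1 ?mulr0 ?normr0.
have c1 : cylinder (fun x V => (f (fun j => input x V (val j)))%:R * chi x V).
  by apply: (@cylinder_view chi i (fun v => (f v)%:R)) => // v;
    case: (f v); rewrite ?normr1 ?normr0.
have c0 : cylinder (fun x V => (~~ f (fun j => input x V (val j)))%:R * chi x V).
  by apply: (@cylinder_view chi i (fun v => (~~ f v)%:R)) => // v;
    case: (f v); rewrite ?normr1 ?normr0.
have d0 : 0 <= delta by apply: le_trans (Pd _ cylinder1).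
have := ler_normD (correlation Psi (fun x V => (run p0 (input x V))%:R *
    ((~~ f (fun j => input x V (val j)))%:R * chi x V)))
  (correlation Psi (fun x V => (run p1 (input x V))%:R *
    ((f (fun j => input x V (val j)))%:R * chi x V))).
rewrite {1}/correlation {1}/correlation -expectD.
rewrite (@eq_expect _ _ _ (fun x => \E_(V : Vs) (Psi x V *
   ((run (Speak f p0 p1) (input x V))%:R * chi x V)))); last first.
  move=> x; rewrite -expectD; apply: eq_expect => V /=.
  by case: (f _) => /=; ring.
move=> /le_trans; apply; apply: le_trans (lerD (IH0 _ c0) (IH1 _ c1)) _.
rewrite -mulrDl ler_wpM2r //= exprS [leRHS]mulr_natl [leRHS]mulr2n.
by apply: lerD; apply: ler_weXn2l; rewrite ?ler1n ?leq_maxl ?leq_maxr.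
Qed.

(** Induction on [l]: one factor of the power is moved into [Psi], and averaging
    [correlation_run_le] over the coins shows that this multiplies [delta] by [2 ^+ c]. *)
Lemma correlation_mix_le (T : finType) (mu : T -> R)
    (p : T -> protocol (fun i => arg i)) (c l : nat)
    (Psi : Xs -> Vs -> R) (delta : R) chi :
  (forall t, 0 <= mu t) -> \sum_t mu t = 1 -> (forall t, (cost (p t) <= c)%N) ->
  (forall chi, cylinder chi -> `|correlation Psi chi| <= delta) ->
  cylinder chi ->
  `|correlation Psi (fun x V =>
      (\sum_t mu t * (run (p t) (input x V))%:R) ^+ l * chi x V)| <=
  (2 ^+ c) ^+ l * delta.
Proof.
move=> mu0 mu1 pc; pose a x V := \sum_t mu t * (run (p t) (input x V))%:R.
elim: l Psi delta chi => [|l IH] Psi delta chi Pd cchi.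
  rewrite expr0 mul1r; have := Pd _ cchi; congr (`|_| <= _).
  by apply: eq_expect => x; apply: eq_expect => V; rewrite expr0 mul1r.
have := IH (fun x V => Psi x V * a x V) (2 ^+ c * delta) chi.
rewrite mulrA -exprSr; set X := correlation _ _ => H.
suff -> : correlation Psi (fun x V => a x V ^+ l.+1 * chi x V) = X.
  apply: H => // chi' cchi'.
  have d0 : 0 <= delta by apply: le_trans (Pd _ cchi').
  rewrite /correlation (@eq_expect _ _ _ (fun x => \sum_t mu t *
     \E_(V : Vs) (Psi x V * ((run (p t) (input x V))%:R * chi' x V)))); last first.
    move=> x; rewrite (@eq_expect _ _ _ (fun V => \sum_t mu t *
       (Psi x V * ((run (p t) (input x V))%:R * chi' x V)))).
      by rewrite expect_sum; apply: eq_bigr => t _; rewrite expectZ.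
    move=> V; rewrite /a mulr_sumr mulr_suml; apply: eq_bigr => t _; ring.
  rewrite expect_sum (eq_bigr (fun t => mu t * correlation Psi
     (fun x V => (run (p t) (input x V))%:R * chi' x V))); last first.
    by move=> t _; rewrite expectZ.
  apply: le_trans (ler_norm_sum _ _ _) _.
  have -> : 2 ^+ c * delta = \sum_t mu t * (2 ^+ c * delta).
    by rewrite -mulr_suml mu1 mul1r.
  apply: ler_sum => t _.
  rewrite normrM ger0_norm // ler_wpM2l //.
 apply: le_trans (correlation_run_le (p t) Pd cchi') _.
  by rewrite ler_wpM2r // ler_weXn2l // ler1n.
apply: eq_expect => x; apply: eq_expect => V; rewrite exprS; ring.
Qed.

End Protocols.

(** The existence of some pair rules out the default value of [xget]. *)
Lemma least_costP (Q : nat -> nat -> Prop) : (exists c1 c2, Q c1 c2) ->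
  exists c1 c2, Q c1 c2 /\ least_cost Q = (c1 + c2)%N.
Proof.
move=> [d1 [d2 Qd]]; pose P c := `[< exists c1 c2, Q c1 c2 /\ c = (c1 + c2)%N >].
have Pd : exists c, P c by exists (d1 + d2)%N; apply/asboolP; exists d1, d2.
have [c /asboolP Qc cmin] := ex_minnP Pd.
rewrite /least_cost; case: xgetP => [_ -> [[c1 [c2 [Qc' ->]]] _]|/(_ c)[]].
  by exists c1, c2.
by split=> // c' Qc'; apply: cmin; apply/asboolP.
Qed.

Lemma nondet_MA (R : realType) (P : finType) (X : P -> Type)
    (G : (forall i, X i) -> R) c1 c2 :
  has_nondet_protocol G c1 c2 -> has_MA_protocol G c1 c2.
Proof.
move=> [p [pc [p1 p0]]]; exists unit, (fun=> 1), (fun g _ => p g) => err.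
have errE g z : correct G (p g) z -> err g z <= 3^-1.
  by move=> gz; rewrite /err big1 ?invr_ge0 // => t; rewrite gz.
split=> //; split; first by rewrite big_const card_unit /= addr0.
split=> //; split; first by move=> z /p1 [g gz]; exists g; apply: errE.
by move=> z /p0 gz g; apply: errE.
Qed.

Lemma run_cost0 (P : finType) (X : P -> Type) (p : protocol X) z z' :
  cost p = 0%N -> run p z = run p z'.
Proof. by case: p. Qed.

(** * Acceptance probabilities *)

Section Acceptance.
Variables (R : realType) (P : finType) (X : P -> Type).
Variables (G : (forall i, X i) -> R) (T : finType) (mu : T -> R).
Variable p : T -> protocol X.
Hypothesis mu1 : \sum_t mu t = 1.

Lemma accept_ge z : G z = -1 -> \sum_(t | ~~ correct G (p t) z) mu t <= 3^-1 ->
  2 / 3 <= \sum_t mu t * (run (p t) z)%:R.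
Proof.
move=> Gz; set err := \sum_(_ | _) _ => errle.
have -> : \sum_t mu t * (run (p t) z)%:R = 1 - err; last by lra.
rewrite -[X in X - _]mu1 /err [X in _ - X]big_mkcond -sumrB; apply: eq_bigr => t _.
rewrite /correct Gz; case: (run _ _) => /=; first by rewrite expr1 eqxx /= mulr1 subr0.
have -> : ((-1) ^+ false == -1 :> R) = false by rewrite expr0; apply/eqP; lra.
by rewrite mulr0 subrr.
Qed.

Lemma accept_le z : G z = 1 -> \sum_(t | ~~ correct G (p t) z) mu t <= 3^-1 ->
  \sum_t mu t * (run (p t) z)%:R <= 3^-1.
Proof.
move=> Gz; apply: le_trans; rewrite [leRHS]big_mkcond /=.
rewrite le_eqVlt; apply/orP; left; apply/eqP/eq_bigr => t _.
rewrite /correct Gz; case: (run _ _) => /=; last by rewrite expr0 eqxx mulr0.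
have -> : ((-1) ^+ true == 1 :> R) = false by rewrite expr1; apply/eqP; lra.
by rewrite mulr1.
Qed.

End Acceptance.

(** * Cost of protocols for the negated pattern tensor of OR *)

Section PatternTensor.
Variables (R : realType) (k N m : nat).
Local Notation r := k.-1.
Local Notation n := (N %/ m)%N.
Local Notation arg := (@pattern_arg k N m).
Local Notation Vs := {ffun 'I_r -> {ffun 'I_m -> 'I_n}}.
Local Notation Xs := {ffun 'I_m * {ffun 'I_r -> 'I_n} -> bool}.
Local Notation zero := ([ffun=> false] : {ffun 'I_m -> bool}).
Local Notation G := (\- @pattern_tensor R k N m (@OR R m)).

Lemma input_surj (z : forall i, arg i) :
  z = input (z None : Xs) [ffun j => z (Some j)].
Proof. by apply: functional_extensionality_dep => -[j|] //=; rewrite ffunE. Qed.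

Lemma neg_pattern_tensor_input x V :
  G (input x V) = if select x V == zero then -1 else 1.
Proof.
rewrite /= pattern_tensor_input /OR.
have -> : [forall i, ~~ select x V i] = (select x V == zero).
  apply/forallP/eqP => [h|-> i]; last by rewrite ffunE.
  by apply/ffunP => i; rewrite [RHS]ffunE; apply/negbTE.
by case: ifP => // _; rewrite opprK.
Qed.

Section Reveal.
Variables (j0 : 'I_r) (b : (forall i, arg i) -> bool).

(** The trivial protocol: player [Some j0], who sees the array, identifies it by running through
    [s]; then player [None], who sees the other arguments, knows the whole input and writes the
    answer. It serves to show that the costs are not defaults. *)
Fixpoint reveal (s : seq Xs) : protocol (fun i => arg i) :=
  if s is x :: s' then
    @Speak _ (fun i => arg i) (Some j0)
      (fun v => (v (exist _ None isT) : Xs) == x) (reveal s')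
      (@Speak _ (fun i => arg i) None
         (fun v => b (input x [ffun j => v (exist _ (Some j) isT)]))
         (Output _ false) (Output _ true))
  else Output _ false.

Lemma run_reveal s z : run (reveal s) z = ((z None : Xs) \in s) && b z.
Proof.
elim: s => [|x s IH] //=; rewrite inE; case: eqP => [<-|_] /=; last exact: IH.
by rewrite -input_surj; case: (b z).
Qed.

End Reveal.

Lemma has_nondet_protocol_exists : (2 <= k)%N ->
  exists c1 c2, has_nondet_protocol G c1 c2.
Proof.
move=> k2; have r0 : (0 < r)%N by case: (k) k2 => [|[]].
pose p := reveal (Ordinal r0) (fun z => G z == -1) (enum Xs).
have pE z : run p z = (G z == -1) by rewrite run_reveal mem_enum.
exists 0%N, (cost p), (fun=> p); split=> //; split=> z Gz.
  by exists [tuple]; rewrite /correct pE Gz eqxx.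
move=> _; rewrite /correct pE Gz (_ : (1 == -1 :> R) = false) ?expr0 //.
by apply/eqP; lra.
Qed.

Hypotheses (k2 : (2 <= k)%N) (m0 : (0 < m)%N) (n0 : (0 < n)%N).

Let V0 : Vs := [ffun=> [ffun=> Ordinal n0]].

(** At cost 0 the acceptance probability of a guess is the same on all inputs, but it has to be at
    least [2 / 3] on one and at most [1 / 3] on another. Positivity later absorbs additive constants
    into multiples of the cost. *)
Lemma MA_cost_gt0 c1 c2 : has_MA_protocol G c1 c2 -> (0 < c1 + c2)%N.
Proof.
move=> [T [mu [p [mu0 [mu1 [pc [p1 p0]]]]]]]; rewrite lt0n; apply/eqP => c0.
have c20 : c2 = 0%N by lia.
pose z b := input ([ffun=> b] : Xs) V0.
have Gz b : G (z b) = if b then 1 else -1.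
  rewrite neg_pattern_tensor_input; case: b; last first.
    by rewrite ifT //; apply/eqP/ffunP => i; rewrite !ffunE.
  rewrite ifF //; apply/eqP => /ffunP/(_ (Ordinal m0)).
  by rewrite !ffunE.
have [g /(accept_ge mu1 (Gz false))] := p1 _ (Gz false).
have /(accept_le (Gz true)) := p0 _ (Gz true) g.
rewrite (eq_bigr (fun t => mu t * (run (p g t) (z false))%:R)); first by lra.
move=> t _; rewrite (@run_cost0 _ _ _ _ (z false)) //.
by apply/eqP; rewrite -leqn0 -c20.
Qed.

(** Where [zero] is selected the integrand is at least [psi zero], elsewhere at least
    [- eps * |psi|]; for fixed [V] the selected string is uniform, so these bounds average as on the
    cube. *)
Lemma correlation_ge (psi : {ffun 'I_m -> bool} -> R) (eps : R) (h : Xs -> Vs -> R) :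
  \E_(z : {ffun 'I_m -> bool}) `|psi z| <= 1 ->
  15^-1 <= 2^-1 ^+ m * psi zero -> 0 <= eps ->
  (forall x V, select x V = zero -> 1 <= h x V) ->
  (forall x V, select x V != zero -> 0 <= h x V <= eps) ->
  15^-1 - eps <= correlation (fun x V => psi (select x V)) h.
Proof.
move=> psi1 psi0 eps0 h1 h0.
have z0 : 0 <= psi zero.
  have m2 : 0 < 2^-1 ^+ m :> R by rewrite exprn_gt0 ?invr_gt0.
  by rewrite -(pmulr_rge0 _ m2); apply: le_trans psi0; rewrite invr_ge0.
pose g z := psi zero * (z == zero)%:R + (- eps) * `|psi z|.
apply: (@le_trans _ _ (\E_(V : Vs) \E_(x : Xs) g (select x V))).
  rewrite (@eq_expect _ _ _ (fun=> expect g)) => [|V]; last exact: expect_read.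
  rewrite (expect_cst V0) /g expectD !expectZ.
  rewrite (_ : \E_(z : _) (z == zero)%:R = 2^-1 ^+ m); last first.
    rewrite /expect (bigD1 zero) //= eqxx big1 => [|z /negPf -> //].
    by rewrite addr0 mulr1 card_ffun card_bool card_ord natrX exprVn.
  rewrite mulrC lerD // mulNr lerN2 ler_piMr //.
rewrite expect_swap; apply: ler_expect => x; apply: ler_expect => V; rewrite /g.
have [sz|sz] := eqVneq (select x V) zero.
  rewrite sz mulr1 mulNr; apply: le_trans (_ : psi zero <= _).
    by rewrite gerBl mulr_ge0.
  by rewrite ler_peMr ?h1.
rewrite mulr0 add0r mulNr lerNl -mulrN mulrC.
have /andP[h00 h01] := h0 _ _ sz; apply: le_trans (ler_norm _) _.
by rewrite normrM normrN (ger0_norm h00) ler_wpM2r // mulrC.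
Qed.

Variables (D : nat) (DI : (D ^ 2 <= m)%N) (D1 : (0 < D)%N) (m1 : (1 < m)%N).
Hypothesis noise :
  (1 + 4 * 2 ^+ (2 ^ r)%N / n%:R) ^+ (m * r) <= 2 ^+ D.+1 :> R.

(** [delta] is the root that undoes the power in [correlation_le]: the noise factor, at most
    [2 ^+ D.+1], leaves [2^-1 ^+ D.+1] of [4^-1 ^+ D.+1]. *)
Lemma small_discrepancy : exists (psi : {ffun 'I_m -> bool} -> R) (delta : R),
  [/\ \E_(z : {ffun 'I_m -> bool}) `|psi z| <= 1,
      15^-1 <= 2^-1 ^+ m * psi zero, 0 <= delta,
      delta ^+ (2 ^ r) = 2^-1 ^+ D.+1 &
      forall chi : Xs -> Vs -> R, cylinder chi ->
        `|correlation (fun x V => psi (select x V)) chi| <= delta].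
Proof.
have [||psi [psiD psi1 psi0]] := @dual_OR R 'I_m D D1; rewrite ?card_ord //.
rewrite card_ord in psi0.
pose eps : R := 2^-1 ^+ D.+1.
have eps0 : 0 <= eps by rewrite exprn_ge0 ?invr_ge0.
pose delta := eps `^ ((2 ^ r)%:R^-1).
have q0 : (0 < 2 ^ r)%N by rewrite expn_gt0.
have dE : delta ^+ (2 ^ r) = eps.
  rewrite -powR_mulrn ?powR_ge0 // -powRrM mulVf ?powRr1 //.
  by rewrite pnatr_eq0 -lt0n.
exists psi, delta; split=> //; first exact: powR_ge0.
move=> chi [chi0 [chij [c0 c1 cI cE]]].
rewrite -(@ler_pXn2r _ (2 ^ r)) ?nnegrE ?powR_ge0 // dE -normrX ger0_norm; last first.
  (* The exponent is even since [2 <= k] gives [0 < r]; this removes the absolute value. *)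
  by rewrite exprn_even_ge0 // oddX orbF; case: (k) k2 => [|[]].
have := correlation_le psiD psi1 c0 c1 cI.
rewrite !card_ord (@eq_expect _ _ _ (fun x => \E_(V : Vs) (psi (select x V) * chi x V))).
  move=> /le_trans; apply; apply: le_trans (_ : 4^-1 ^+ D.+1 * 2 ^+ D.+1 <= _).
    by rewrite ler_wpM2l ?exprn_ge0 ?invr_ge0.
  by rewrite -exprMn /eps le_eqVlt; apply/orP; left; apply/eqP; congr (_ ^+ _); lra.
by move=> x; apply: eq_expect => V; rewrite cE.
Qed.

(** The correlation of [h] with [psi] is bounded below by [correlation_ge] and above by
    [correlation_mix_le], summed over the [2 ^ c1] guesses. Raising to the power [2 ^ r] and
    comparing exponents of 2 gives the inequality. *)
Lemma threshold_cost (c1 c2 l e : nat) (K : R) (T : finType) (mu : T -> R)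
    (p : c1.-tuple bool -> T -> protocol (fun i => arg i)) :
  let h z := \sum_g K * (\sum_t mu t * (run (p g t) z)%:R) ^+ l in
  0 <= K <= 2 ^+ e -> (forall t, 0 <= mu t) -> \sum_t mu t = 1 ->
  (forall g t, (cost (p g t) <= c2)%N) ->
  (forall x V, select x V = zero -> 1 <= h (input x V)) ->
  (forall x V, select x V != zero -> h (input x V) <= 32^-1) ->
  (D.+1 <= (c1 + e + c2 * l + 5) * 2 ^ r)%N.
Proof.
move=> h /andP[K0 Ke] mu0 mu1 pc h1 h0.
have [psi [delta [psi1 psi0 d0 dE disc]]] := small_discrepancy.
have hge0 z : 0 <= h z.
  apply: sumr_ge0 => g _; rewrite mulr_ge0 // exprn_ge0 // sumr_ge0 // => t _.
  by rewrite mulr_ge0.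
have lo : 15^-1 - 32^-1 <=
    correlation (fun x V => psi (select x V)) (fun x V => h (input x V)).
  apply: correlation_ge => //; first by rewrite invr_ge0.
  by move=> x V /h0 ->; rewrite hge0.
have up : correlation (fun x V => psi (select x V)) (fun x V => h (input x V)) <=
    2 ^+ (c1 + e + c2 * l) * delta.
  pose F g x V : R := (\sum_t mu t * (run (p g t) (input x V))%:R) ^+ l * 1.
  rewrite /correlation (@eq_expect _ _ _ (fun x => \sum_g
      K * \E_(V : Vs) (psi (select x V) * F g x V))); last first.
    move=> x; rewrite (@eq_expect _ _ _ (fun V => \sum_g
        K * (psi (select x V) * F g x V))).
      by rewrite expect_sum; apply: eq_bigr => g _; rewrite expectZ.
    by move=> V; rewrite /h mulr_sumr; apply: eq_bigr => g _; rewrite /F mulr1 mulrCA.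
  rewrite expect_sum; apply: le_trans (_ : \sum_(g : c1.-tuple bool)
     2 ^+ e * ((2 ^+ c2) ^+ l * delta) <= _); last first.
    rewrite sumr_const card_tuple card_bool -[leLHS]mulr_natl natrX !mulrA.
    by rewrite -exprM !exprD.
  apply: ler_sum => g _; rewrite expectZ; apply: le_trans (ler_norm _) _.
  rewrite normrM (ger0_norm K0) ler_pM //.
  exact: (correlation_mix_le l mu0 mu1 (pc g) disc (cylinder1 R k N m)).
(* The summand 5 of the conclusion comes from [2^-1 ^+ 5 <= 15^-1 - 32^-1]. *)
have : 2^-1 ^+ 5 <= 2 ^+ (c1 + e + c2 * l) * delta :> R.
  apply: le_trans (le_trans lo up); rewrite !exprS expr0; lra.
rewrite -(@ler_pXn2r _ (2 ^ r)) ?nnegrE ?expn_gt0 ?mulr_ge0 ?exprn_ge0 ?invr_ge0 //.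
rewrite [leRHS]exprMn dE -!exprM !exprVn ler_pdivlMr ?exprn_gt0 //.
rewrite mulrC ler_pdivrMr ?exprn_gt0 // -exprD ler_eXn2l ?ltr1n //.
by rewrite -mulnDl.
Qed.

(** With a one-point coin space, [K = 1] and [l = 1], [h] counts the accepting guesses: at least one
    if [zero] is selected, none otherwise. *)
Lemma nondet_cost_ge c1 c2 : has_nondet_protocol G c1 c2 ->
  (D.+1 <= (c1 + c2 + 5) * 2 ^ r)%N.
Proof.
move=> [p [pc [p1 p0]]].
have tot z : \sum_(t : unit) (1 : R) * (run (p z.1) z.2)%:R = (run (p z.1) z.2)%:R.
  by rewrite big_const card_unit /= addr0 mul1r.
have := @threshold_cost c1 c2 1 0 1 unit (fun=> 1) (fun g _ => p g).
rewrite addn0 muln1; apply=> //.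
- by rewrite ler01 expr0 lexx.
- by rewrite big_const card_unit /= addr0.
- move=> x V sz; have [] := p1 (input x V).
    by rewrite neg_pattern_tensor_input sz eqxx.
  move=> g gz; rewrite (bigD1 g) //= (tot (g, _)) /=.
  have -> : run (p g) (input x V) = true.
    move: gz; rewrite /correct neg_pattern_tensor_input sz eqxx.
    by case: (run _ _) => //; rewrite expr0 => /eqP; lra.
  rewrite expr1 mul1r lerDl sumr_ge0 // => g' _.
  by rewrite (tot (g', _)) mul1r expr1.
- move=> x V /negPf sz; rewrite big1 ?invr_ge0 // => g _.
  rewrite (tot (g, _)) /= mul1r expr1.
  have := p0 (input x V); rewrite neg_pattern_tensor_input sz => /(_ erefl g).
  rewrite /correct neg_pattern_tensor_input sz.
  by case: (run _ _) => //; rewrite expr1 => /eqP; lra.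
Qed.

(* The power [(3 a / 2) ^ l] amplifies the acceptance probability [a] in the
   one-sided way that suffices here: it is at least 1 when [2 / 3 <= a] and at
   most [2 ^ - l] when [a <= 1 / 3]. *)
Lemma MA_cost_ge c1 c2 : has_MA_protocol G c1 c2 ->
  (D.+1 <= (c1 + (c1 + 5) + c2 * (c1 + 5) + 5) * 2 ^ r)%N.
Proof.
move=> [T [mu [p [mu0 [mu1 [pc [p1 p0]]]]]]].
have a0 g z : 0 <= \sum_t mu t * (run (p g t) z)%:R.
  by apply: sumr_ge0 => t _; rewrite mulr_ge0.
apply: (@threshold_cost c1 c2 (c1 + 5) (c1 + 5) ((3 / 2) ^+ (c1 + 5)) T mu p) => //.
- by rewrite exprn_ge0 ?lerXn2r ?nnegrE //; lra.
- move=> x V sz; have [|g] := p1 (input x V).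
    by rewrite neg_pattern_tensor_input sz eqxx.
  move=> /(accept_ge mu1); rewrite neg_pattern_tensor_input sz eqxx => /(_ erefl) ag.
  rewrite (bigD1 g) //=; apply: ler_wpDr.
    by apply: sumr_ge0 => g' _; rewrite mulr_ge0 ?exprn_ge0 //; lra.
  by rewrite -exprMn exprn_ege1 //; lra.
- move=> x V /negPf sz.
  (* The exponent [c1 + 5] is chosen so that the [2 ^ c1] guesses together contribute at most
     [2^-1 ^+ 5 = 32^-1]. *)
  apply: le_trans (_ : \sum_(g : c1.-tuple bool) 2^-1 ^+ (c1 + 5) <= _).
    apply: ler_sum => g _; rewrite -exprMn.
    have := p0 (input x V); rewrite neg_pattern_tensor_input sz => /(_ erefl g).
    move=> /accept_le; rewrite neg_pattern_tensor_input sz => /(_ erefl) ag.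
    have ag0 := a0 g (input x V).
    by apply: lerXn2r; rewrite ?nnegrE; lra.
  rewrite sumr_const card_tuple card_bool -[leLHS]mulr_natl natrX exprD mulrA -exprMn.
  by rewrite divff ?pnatr_eq0 // expr1n mul1r !exprS expr0; lra.
Qed.

End PatternTensor.

(** By [1 + t <= expR t] the left side is at most the exponential of [4 * A * m * r / n]. The
    hypothesis, with [2 <= expR 1], bounds this exponent by half of [sqrt m], hence by [D.+1 / 2],
    and [expR (2^-1) <= 2]. *)
Lemma noise_le (R : realType) (n m r D : nat) : (0 < m)%N -> (0 < n)%N ->
  (m < D.+1 ^ 2)%N ->
  4 * expR 1 * m%:R ^+ 2 * r%:R * 2 ^+ (2 ^ r)%N / (1 * Num.sqrt m%:R) <=
    (n * m)%:R :> R ->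
  (1 + 4 * 2 ^+ (2 ^ r)%N / n%:R) ^+ (m * r) <= 2 ^+ D.+1 :> R.
Proof.
move=> m0 n0 mD; set A := 2 ^+ (2 ^ r)%N; set s := Num.sqrt _.
have n0' : 0 < n%:R :> R by rewrite ltr0n.
have m0' : 0 < m%:R :> R by rewrite ltr0n.
have s0 : 0 < s by rewrite sqrtr_gt0.
have ss : s ^+ 2 = m%:R by rewrite sqr_sqrtr // ltW.
have sD : s <= D.+1%:R.
  rewrite -(@ler_pXn2r _ 2) ?nnegrE ?(ltW s0) // ss -natrX ler_nat.
  exact: ltnW.
have A0 : 0 <= A by rewrite exprn_ge0.
have e2 : 2 <= expR 1 :> R by have := expR_ge1Dx (1 : R); lra.
rewrite mul1r ler_pdivrMr // natrM => H.
have H1 : 8 * (m%:R * r%:R * A) <= n%:R * s.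
  rewrite -(ler_pM2r m0').
  have : 2 * (4 * m%:R ^+ 2 * r%:R * A) <= expR 1 * (4 * m%:R ^+ 2 * r%:R * A).
    by rewrite ler_wpM2r // !mulr_ge0 // exprn_ge0.
  move: H; move: (expR 1) (m%:R : R) (n%:R : R) (r%:R : R) (A) (s) => e x y z a b; lra.
have half : expR (2^-1) <= 2 :> R.
  have := expR_ge1Dx (- 2^-1 : R); rewrite expRN => h.
  rewrite -(ler_pV2 _ _) ?inE ?unitfE ?gt_eqF ?expR_gt0 //=; lra.
apply: (@le_trans _ _ (expR (4 * A / n%:R) ^+ (m * r))).
  by rewrite lerXn2r ?nnegrE ?expR_ge0 ?expR_ge1Dx // addr_ge0 // divr_ge0 // mulr_ge0.
apply: (@le_trans _ _ (expR (2^-1) ^+ D.+1)); last first.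
  by rewrite lerXn2r ?nnegrE ?expR_ge0.
rewrite -!expRM_natl ler_expR natrM mulrA ler_pdivrMr //.
apply: le_trans (_ : s * n%:R / 2 <= _); first by lra.
by rewrite mulrAC ler_wpM2r ?(ltW n0') // ler_wpM2r ?invr_ge0.
Qed.

Theorem theorem6p2 (R : realType) :
  exists c C : R, 0 < c /\ 0 < C /\
    forall k m N : nat, (2 <= k)%N -> (1 <= m)%N -> (m %| N)%N ->
    let d : R := c * Num.sqrt m%:R in
    let F := @pattern_tensor R k N m (@OR R m) in
    4 * expR 1 * m%:R ^+ 2 * k.-1%:R * 2 ^+ (2 ^ k.-1)%N / d <= N%:R ->
    C * (Num.sqrt m%:R / 2 ^+ k) <= (nondet_complexity (\- F))%:R /\
    C * (m%:R `^ (4^-1) / 2 `^ (k%:R / 2)) <= (MA_complexity (\- F))%:R.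
Proof.
(* The quantity [sqrt m / 2 ^ k] will be at most [3 * (c1 + c2)] in the nondeterministic case,
   whence [C = 3^-1], and at most [8 * (c1 + c2) ^ 2] in the Merlin-Arthur case, where [8 <= 3 ^ 2]
   suffices. *)
exists 1, (3^-1); split=> //; split; first by rewrite invr_gt0.
move=> k m N k2 m0 mN d F hN.
have m0' : 0 < m%:R :> R by rewrite ltr0n.
have N0 : (0 < N)%N.
  rewrite -(ltr0n R); apply: lt_le_trans hN; rewrite divr_gt0 //.
    rewrite !mulr_gt0 ?exprn_gt0 ?expR_gt0 ?ltr0n //.
    by case: (k) k2 => [|[]].
  by rewrite /d mul1r sqrtr_gt0.
have NE : N = (N %/ m * m)%N by rewrite divnK.
have n0 : (0 < N %/ m)%N by rewrite divn_gt0 // dvdn_leq.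
(* [D] is the integer square root of [m]. *)
have [D /andP[DI mD]] : exists D, (D ^ 2 <= m < D.+1 ^ 2)%N.
  elim: (m) => [|i [D /andP[Di iD]]]; first by exists 0%N.
  have [iD'|iD'] := ltnP i.+1 (D.+1 ^ 2).
    by exists D; rewrite iD' (leq_trans Di) //.
  by exists D.+1; rewrite iD' /=; nia.
have D1 : (0 < D)%N by rewrite lt0n; apply: contraTneq mD => ->; rewrite -leqNgt.
have noise : (1 + 4 * 2 ^+ (2 ^ k.-1)%N / (N %/ m)%:R) ^+ (m * k.-1) <=
    2 ^+ D.+1 :> R by apply: noise_le => //; rewrite -NE.
pose s : R := Num.sqrt m%:R.
have s0 : 0 <= s by exact: sqrtr_ge0.
have ss : s ^+ 2 = m%:R by rewrite sqr_sqrtr // ltW.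
have sD : s <= D.+1%:R.
  rewrite -(@ler_pXn2r _ 2) ?nnegrE // ss -natrX ler_nat.
  exact: ltnW.
have q0 : (0 < 2 ^ k.-1)%N by rewrite expn_gt0.
have k2E : 2 ^+ k = 2 * (2 ^ k.-1)%:R :> R.
  by rewrite natrX -exprS prednK // ltnW.
(* For [m = 1] the node 2 is not a level of the cube; then [D = 1], and positivity of the cost
   already gives both bounds. *)
have Dm1 : (m <= 1)%N -> D = 1%N by move: DI m0 D1; case: (D) => [|[|d']] //; nia.
have ratio (a : nat) : (D.+1 <= a * 2 ^ k.-1)%N -> s / 2 ^+ k <= a%:R / 2.
  move=> Da; rewrite k2E ler_pdivrMr ?mulr_gt0 ?ltr0n //.
  rewrite mulrA divfK ?pnatr_eq0 // -natrM; apply: le_trans sD _.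
  by rewrite ler_nat.
have [b1 [b2 Qb]] := has_nondet_protocol_exists R N m k2.
split.
  rewrite /nondet_complexity.
  have [|c1 [c2 [Qc ->]]] := @least_costP (has_nondet_protocol (\- F)).
    by exists b1, b2.
  have c0 := MA_cost_gt0 k2 m0 n0 (nondet_MA Qc).
  have Dc : (D.+1 <= 6 * (c1 + c2) * 2 ^ k.-1)%N.
    have [m1|m1] := leqP m 1; first by rewrite Dm1 //; nia.
    apply: leq_trans (nondet_cost_ge k2 n0 DI D1 m1 noise Qc) _.
    by rewrite leq_mul2r; apply/orP; right; lia.
  rewrite mulrC ler_pdivrMr //; apply: le_trans (ratio _ Dc) _.
  by rewrite natrM mulrAC; lra.
rewrite /MA_complexity.
have [|c1 [c2 [Qc ->]]] := @least_costP (has_MA_protocol (\- F)).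
  by exists b1, b2; exact: nondet_MA.
have c0 := MA_cost_gt0 k2 m0 n0 Qc.
(* The product [c2 * (c1 + 5)] makes the bound quadratic in the cost; as the cost is positive, 16
   absorbs the lower-order terms. *)
have Dc : (D.+1 <= 16 * (c1 + c2) ^ 2 * 2 ^ k.-1)%N.
  have [m1|m1] := leqP m 1; first by rewrite Dm1 //; nia.
  apply: leq_trans (MA_cost_ge k2 n0 DI D1 m1 noise Qc) _.
  by rewrite leq_mul2r; apply/orP; right; nia.
set t := _ `^ _ / _; have t0 : 0 <= t by rewrite divr_ge0 ?powR_ge0.
have tE : t ^+ 2 = s / 2 ^+ k.
  rewrite /t exprMn exprVn -!(@powR_mulrn R _ 2) ?powR_ge0 // -!powRrM.
  rewrite -(powR_mulrn k) // -mulrA mulVf ?pnatr_eq0 // mulr1.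
  by rewrite (_ : 4^-1 * 2 = 2^-1) ?powR12_sqrt ?(ltW m0') //; lra.
have u0 : 0 <= 3^-1 * t by apply: mulr_ge0; rewrite ?invr_ge0.
rewrite -(@ler_pXn2r _ 2) ?nnegrE // exprMn tE.
rewrite mulrC; apply: le_trans (ler_wpM2r _ (ratio _ Dc)) _.
  by rewrite exprn_ge0 ?invr_ge0.
rewrite natrM -[X in _ <= X]natrX; have : 0 <= ((c1 + c2) ^ 2)%:R :> R by [].
by move: (((c1 + c2) ^ 2)%:R : R) => a a0; rewrite exprS expr1; lra.
Qed.
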